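(* For all $\alpha>0$, $\beta\in\mathbb R$ and $\sigma>0$, the asymptotic density $w(x,j)=\lim_{t\to+\infty}f(x,j,t)$ of the Ornstein-Uhlenbeck diffusion on the spider with $d$ rays and switching matrix $C$ (see context) satisfies $$w(x,j)=w(x)\,\pi_j,\qquad \forall x\in\mathbb R^+\cup\{0\},\ j\in D,$$ where $(\pi_1,\dots,\pi_d)$ is the vector of the stationary probabilities of the Markov chain having transition matrix $C$, and $w(x)=\sum_{j\in D}w(x,j)$ is given by $$w(x)=\frac1Q\exp\left\{-\frac{2\alpha x}{\sigma^2}\left(\frac x2-\beta\right)\right\},\qquad x\in\mathbb R^+\cup\{0\},$$ where $Q$ is the normalizing constant $$Q=\frac{\sigma\sqrt{\pi}}{2\sqrt{\alpha}}\left(1+\mathrm{Erf}\left(\frac{\sqrt\alpha}{\sigma}\beta\right)\right)\exp\left\{\frac{\alpha\beta^2}{\sigma^2}\right\}$$ (in this last formula $\pi$ is the number $\pi$), and $\mathrm{Erf}(x)=\frac{2}{\sqrt\pi}\int_0^xe^{-t^2}dt$ is the error function.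
   Context: Let $d\in\mathbb N$, $D=\{1,\dots,d\}$, and let $C=(c_{l,j})_{l,j\in D}$ be a stochastic matrix ($c_{l,j}\ge0$, $\sum_{j\in D}c_{l,j}=1$). The spider is the star graph $\{0\}\cup(\mathbb R^+\times D)$, i.e. $d$ half-lines (rays) joined at the origin. The Ornstein-Uhlenbeck diffusion on the spider is the process $(X(t),\mathcal L(t))$, $t\ge 0$, with $X(t)$ the position and $\mathcal L(t)$ the occupied ray, started at the origin with last visited ray $l_0\in D$. It arises as the weak limit of a scaled birth-death process on $d$ rays (a multi-type Ehrenfest model) whose rates at site $k\in\{1,\dots,N\}$ of any ray are $\lambda(N-k)$ upward and $\mu(N+k)$ downward, and which, from the origin, when the last visited ray is $l$, jumps to the first site of ray $j$ at rate $c_{l,j}\lambda N$; here $\lambda=\frac\alpha2+\frac\gamma2\epsilon$, $\mu=\frac\alpha2-\frac\gamma2\epsilon$ with $|\gamma|<\alpha/\epsilon$, sites are spaced by $\epsilon$, and $\epsilon\to0^+$, $N\to+\infty$, $N\epsilon\to+\infty$, $N\epsilon^2\to\nu>0$, with $\sigma^2=\alpha\nu$ and $\beta=\gamma\nu/\alpha$. Its density is denoted by $f$: $f(x,j,t)$ is the probability density of the process at time $t$ in the state $x\in\mathbb R^+$ along ray $j$, and $f(0,l,t)$ is the density at the origin with last visited ray $l$. It has initial condition $f(x,j,0)=\delta(x)\,\delta_{j,l_0}$ (Dirac delta in $x$, Kronecker delta in $j$) and satisfies, for $t>0$ and $j\in D$: (i) $\partial_tf(x,j,t)=-\partial_x\{[-\alpha(x-\beta)]f(x,j,t)\}+\frac12\sigma^2\partial_x^2f(x,j,t)$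 for $x\in\mathbb R^+$; (ii) $\sum_{l\in D}\left\{\alpha\beta f(0,l,t)-\frac{\sigma^2}{2}\partial_xf(x,l,t)|_{x=0}\right\}=0$; (iii) $f(0,j,t)=\sum_{l\in D}c_{l,j}f(0,l,t)$; (iv) $\lim_{x\to+\infty}f(x,j,t)=0$. The function $w(x,j)$ is the (sub)density, related to the $j$-th ray, of the two-dimensional random variable $(X,\mathcal L)$ describing the asymptotic behavior of the process, and $w(x)$ is the probability density function of $X$. *)

(* Defs.v *)
From mathcomp Require Import all_boot all_order all_algebra.
From mathcomp Require Import all_classical all_reals all_analysis.

Set Implicit Arguments.
Unset Strict Implicit.
Unset Printing Implicit Defensive.

Import Order.TTheory GRing.Theory Num.Theory.
Import numFieldNormedType.Exports.

Local Open Scope classical_set_scope.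
Local Open Scope ring_scope.

Section MarkovChain.
Variables (R : realType) (d : nat).

Definition stochastic_matrix (C : 'M[R]_d) : Prop :=
  (forall l j, 0 <= C l j) /\ (forall l, \sum_j C l j = 1).

Definition stationary_distribution (C : 'M[R]_d) (p : 'rV[R]_d) : Prop :=
  [/\ forall j, 0 <= p 0 j, \sum_j p 0 j = 1 & p *m C = p].

End MarkovChain.

Section Erf.
Variable R : realType.
Notation mu := (@lebesgue_measure R).

(* The second integral makes the integral from 0 to x oriented: one of the two
   intervals is always empty or a single point. *)
Definition erf (x : R) : R :=
  2 / Num.sqrt pi *
  (\int[mu]_(t in `[0, x]) expR (- t ^+ 2)
   - \int[mu]_(t in `[x, 0]) expR (- t ^+ 2)).

End Erf.

Section RightDerivative.
Variable R : realType.

Definition right_derivable (g : R -> R) (x : R) : Prop :=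
  cvg (h^-1 * (g (x + h) - g x) @[h --> 0^'+]).

Definition right_derive (g : R -> R) (x : R) : R :=
  lim (h^-1 * (g (x + h) - g x) @[h --> 0^'+]).

End RightDerivative.

(* Throughout, f x j t is the density at abscissa x of ray j at time t. Only
   the values with 0 <= x and 0 < t are meaningful; those at x = 0 are the
   densities at the origin indexed by the last visited ray j. *)
Section Spider.
Variables (R : realType) (d : nat).
Notation mu := (@lebesgue_measure R).
Implicit Type f : R -> 'I_d -> R -> R.

(* Classical solution of a parabolic equation on each ray: C^{2,1} for x > 0,
   and C^1 in x up to the boundary x = 0. For x > 0 the right derivative in x
   is the ordinary one, by the third condition. *)
Definition classical_regularity f : Prop :=
  forall j : 'I_d,
  [/\ {within [set z : R * R | 0 <= z.1 /\ 0 < z.2],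
        continuous (fun z : R * R => f z.1 j z.2)},
      forall t, 0 < t -> right_derivable (fun y => f y j t) 0,
      forall x t, 0 < x -> 0 < t ->
        [/\ derivable (fun y => f y j t) x 1,
            derivable (derive1 (fun y => f y j t)) x 1
          & derivable (f x j) t 1],
      {within [set z : R * R | 0 <= z.1 /\ 0 < z.2],
        continuous (fun z : R * R => right_derive (fun y => f y j z.2) z.1)}
    & {within [set z : R * R | 0 < z.1 /\ 0 < z.2],
        continuous (fun z : R * R => derive1 (f z.1 j) z.2)} /\
      {within [set z : R * R | 0 < z.1 /\ 0 < z.2],
        continuous (fun z : R * R => derive1n 2 (fun y => f y j z.2) z.1)}].

Definition probability_density f : Prop :=
  forall t, 0 < t ->
    (forall x j, 0 <= x -> 0 <= f x j t) /\
    (\sum_(j < d) \int[mu]_(x in `[0%R, +oo[) (f x j t)%:E = 1)%E.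

(* A bounded continuous function on the star graph: the d rays share the
   point x = 0, so the value there is the same on all rays. *)
Definition spider_test_function (phi : R -> 'I_d -> R) : Prop :=
  [/\ forall j, {within `[0, +oo[, continuous (phi ^~ j)},
      exists M, forall x j, 0 <= x -> `|phi x j| <= M
    & forall j l, phi 0 j = phi 0 l].

(* f(x,j,0) = delta(x) delta_{j,l0} as weak convergence of probability
   measures on the star graph when t -> 0+. Testing ray by ray with unrelated
   values phi 0 j would be incompatible with the switching condition, which
   forces f(.,j,t) to carry mass pi_j as soon as t > 0, for every l0. *)
Definition starts_at_origin (l0 : 'I_d) f : Prop :=
  forall phi, spider_test_function phi ->
    (\sum_(j < d) \int[mu]_(x in `[0, +oo[) (phi x j * f x j t))
      @[t --> 0^'+] --> phi 0 l0.

Variables (alpha beta sigma : R).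

Definition ou_forward_equation f : Prop :=
  forall x j t, 0 < x -> 0 < t ->
    derive1 (f x j) t =
      - derive1 (fun y => - alpha * (y - beta) * f y j t) x
      + 2^-1 * sigma ^+ 2 * derive1n 2 (fun y => f y j t) x.

Definition zero_flux_at_origin f : Prop :=
  forall t, 0 < t ->
    \sum_(l < d) (alpha * beta * f 0 l t
      - sigma ^+ 2 / 2 * right_derive (fun x => f x l t) 0) = 0.

Definition switching_condition (C : 'M[R]_d) f : Prop :=
  forall j t, 0 < t -> f 0 j t = \sum_(l < d) C l j * f 0 l t.

Definition vanishes_at_infinity f : Prop :=
  forall j t, 0 < t -> f x j t @[x --> +oo] --> 0.

Record ou_spider_density (C : 'M[R]_d) (l0 : 'I_d) f : Prop := {
  ousd_regularity : classical_regularity f ;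
  ousd_density : probability_density f ;
  ousd_initial : starts_at_origin l0 f ;
  ousd_forward : ou_forward_equation f ;
  ousd_flux : zero_flux_at_origin f ;
  ousd_switching : switching_condition C f ;
  ousd_infinity : vanishes_at_infinity f
}.

Definition asymptotic_density f (x : R) (j : 'I_d) : R :=
  lim (f x j t @[t --> +oo]).

Definition normalizing_constant : R :=
  sigma * Num.sqrt pi / (2 * Num.sqrt alpha)
  * (1 + erf (Num.sqrt alpha / sigma * beta))
  * expR (alpha * beta ^+ 2 / sigma ^+ 2).

End Spider.

(* Main.v *)
Require Import Defs.
From mathcomp Require Import all_boot all_order all_algebra.
From mathcomp Require Import all_classical all_reals all_analysis.
From mathcomp Require Import measurable_realfun ring lra.

Import Order.TTheory GRing.Theory Num.Theory.
Import numFieldNormedType.Exports.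

Local Open Scope classical_set_scope.
Local Open Scope ring_scope.

(** The total density [g = sum_j f(., j, .)] solves the forward equation with
    zero flux at the origin, so its primitive [G(x, t) = int_0^x g] solves
    [G_t = (sigma^2/2) G_xx + alpha (x - beta) G_x] with [G(0, t) = 0]; the
    boundary flux has disappeared and [0 <= G <= 1]. Let [E] be the difference
    between [G] and the distribution function of the limit law. As [|E| <= 1],
    [E(., 1)] tends to 0 at infinity, and the Gaussian
    [exp (- (alpha / sigma^2) (x - beta)^2)], multiplied by [exp (- alpha t)],
    solves the same equation, the maximum principle yields [E -> 0] uniformly
    in [x]. Gradient bounds, by a barrier at [x = 0] and by doubling the space
    variable at [x > 0], turn this into the pointwise convergence of [g = G_x].

    The functions [h_j = f(., j, .) - p_j g] vanish at the origin, because the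
    nonnegative vector [f(0, ., t)] is left invariant by [C], hence
    proportional to [p]. Moreover [|h_j| <= g] and [g] converges, so that
    [h_j] divided by the Gaussian weight is eventually bounded at each [X],
    uniformly in [X]. It solves the backward equation, for which a Lyapunov
    function increasing to infinity makes it negligible to reach a far [X]
    before the origin; hence [h_j -> 0]. *)

(** * Calculus on the real line *)

Section Calculus.
Variable R : realType.
Implicit Types (f g : R -> R) (x t : R).

Lemma is_derive_fcst (c x : R) : is_derive x 1 (fun=> c) 0.
Proof. exact: is_derive_cst. Qed.

Lemma is_derive_fid (x : R) : is_derive x 1 (fun y : R => y) 1.
Proof. exact: is_derive_id. Qed.

Lemma is_derive_fD f g x (a b : R) : is_derive x 1 f a -> is_derive x 1 g b ->
  is_derive x 1 (fun y => f y + g y) (a + b).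
Proof. by move=> fa gb; exact: is_deriveD. Qed.

Lemma is_derive_fN f x (a : R) : is_derive x 1 f a ->
  is_derive x 1 (fun y => - f y) (- a).
Proof. by move=> fa; exact: is_deriveN. Qed.

Lemma is_derive_fM f g x (a b : R) : is_derive x 1 f a -> is_derive x 1 g b ->
  is_derive x 1 (fun y => f y * g y) (f x * b + g x * a).
Proof. by move=> fa gb; exact: is_deriveM. Qed.

Lemma is_derive_fexp f x (a : R) : is_derive x 1 f a ->
  is_derive x 1 (fun y => expR (f y)) (expR (f x) * a).
Proof. by move=> fa; exact: (is_derive1_comp (is_derive_expR _) fa). Qed.

Lemma is_derive_affine f (c k x a : R) : is_derive (c + k * x) 1 f a ->
  is_derive x 1 (fun y => f (c + k * y)) (k * a).
Proof.
move=> fa; rewrite mulrC; apply: (@is_derive1_comp R f (fun y => c + k * y)) => //.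
have := is_derive_fD _ _ _ _ _ (is_derive_fcst c x)
  (is_derive_fM _ _ _ _ _ (is_derive_fcst k x) (is_derive_fid x)).
by rewrite add0r mulr1 mulr0 addr0.
Qed.

Lemma is_derive_faddl f (c x a : R) : is_derive (c + x) 1 f a ->
  is_derive x 1 (fun y => f (c + y)) a.
Proof.
move=> fa; have := @is_derive_affine f c 1 x a; rewrite !mul1r => /(_ fa).
by under eq_fun do rewrite mul1r.
Qed.

Lemma is_derive_faddr f (c x a : R) : is_derive (x + c) 1 f a ->
  is_derive x 1 (fun y => f (y + c)) a.
Proof.
move=> fa; have := @is_derive_faddl f c x a; rewrite addrC => /(_ fa).
by under eq_fun do rewrite addrC.
Qed.

Lemma is_derive_fsubl f (c x a : R) : is_derive (c - x) 1 f a ->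
  is_derive x 1 (fun y => f (c - y)) (- a).
Proof.
move=> fa; have := @is_derive_affine f c (- 1) x a; rewrite !mulN1r => /(_ fa).
by under eq_fun do rewrite mulN1r.
Qed.

Lemma is_derive_fsqr f x (a : R) : is_derive x 1 f a ->
  is_derive x 1 (fun y => f y ^+ 2) (2 * f x * a).
Proof.
move=> fa; have := is_derive_fM _ _ _ _ _ fa fa.
by under eq_fun do rewrite -expr2; rewrite -mulrDl -mulr2n mulr_natl.
Qed.

Lemma is_derive_quotient f x (a : R) : is_derive x 1 f a ->
  h^-1 * (f (x + h) - f x) @[h --> 0^'] --> a.
Proof.
case=> dfx <-.
have : h^-1 *: ((f \o shift x) (h *: 1) - f x) @[h --> 0^'] --> 'D_1 f x := dfx.
apply: cvg_trans; apply: near_eq_cvg; near=> h.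
by rewrite /= [h%:A]mulr1 (addrC h).
Unshelve. all: by end_near. Qed.

Lemma quotient_is_derive f x (a : R) :
  h^-1 * (f (x + h) - f x) @[h --> 0^'] --> a -> is_derive x 1 f a.
Proof.
move=> fa; have fa' : h^-1 *: ((f \o shift x) (h *: 1) - f x) @[h --> 0^'] --> a.
  move: fa; apply: cvg_trans; apply: near_eq_cvg; near=> h.
  by rewrite /= [h%:A]mulr1 (addrC h).
by apply: DeriveDef; [apply/cvg_ex; exists a|exact/cvg_lim].
Unshelve. all: by end_near. Qed.

(** The left difference quotients are nonnegative. A comparison with earlier points only is what a
    maximum at the final time of a rectangle provides. *)
Lemma derive_ge0_left_max f t (a : R) : is_derive t 1 f a ->
  (\forall y \near t^'-, f y <= f t) -> 0 <= a.
Proof.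
move=> /is_derive_quotient fa fmax.
have fl : h^-1 * (f (t + h) - f t) @[h --> 0^'-] --> a.
  by apply: cvg_trans fa; apply: cvg_app; apply: within_subset => h /=; exact: ltr0_neq0.
apply: (cvgr_to_ge fl).
move: fmax; rewrite near_withinE => /nbhs_ballP[e /= e0 he].
near=> h.
have h0 : h < 0 by near: h; exact: nbhs_left_lt.
apply: mulr_le0; first by rewrite invr_le0 ltW.
rewrite subr_le0 he//=; last by rewrite gtrDl.
rewrite /ball/= opprD addrA subrr add0r normrN ltr0_norm// ltrNl.
by near: h; apply: nbhs_left_gt; rewrite oppr_lt0.
Unshelve. all: by end_near. Qed.

Lemma derive_le0_right_max f x (a : R) : is_derive x 1 f a ->
  (\forall y \near x^'+, f y <= f x) -> a <= 0.
Proof.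
move=> /is_derive_quotient fa fmax.
have fl : h^-1 * (f (x + h) - f x) @[h --> 0^'+] --> a.
  by apply: cvg_trans fa; apply: cvg_app; apply: within_subset => h /=; exact: lt0r_neq0.
apply: (cvgr_to_le fl).
move: fmax; rewrite near_withinE => /nbhs_ballP[e /= e0 he].
near=> h.
have h0 : 0 < h by near: h; exact: nbhs_right_gt.
apply: mulr_ge0_le0; first by rewrite invr_ge0 ltW.
rewrite subr_le0 he//=; last by rewrite ltrDl.
rewrite /ball/= opprD addrA subrr add0r normrN (gtr0_norm h0).
by near: h; apply: nbhs_right_lt.
Unshelve. all: by end_near. Qed.

Lemma derive_eq0_max f x (a : R) : is_derive x 1 f a ->
  (\forall y \near x, f y <= f x) -> a = 0.
Proof.
move=> fa fmax; apply/eqP; rewrite eq_le; apply/andP; split.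
  by apply: (derive_le0_right_max _ _ _ fa); exact: cvg_within.
by apply: (derive_ge0_left_max _ _ _ fa); exact: cvg_within.
Qed.

(** Otherwise [f1], which vanishes at the maximum, would be positive just to its right, and the mean
    value theorem would make [f] exceed its maximum there. *)
Lemma derive2_le0_max f (f1 : R -> R) x (q : R) :
  (\forall y \near x, is_derive (y : R) (1 : R) f (f1 y)) -> is_derive x 1 f1 q ->
  (\forall y \near x, f y <= f x) -> q <= 0.
Proof.
move=> ff1 f1q fmax; rewrite leNgt; apply/negP => q0.
have f1x : f1 x = 0 by apply: (derive_eq0_max _ _ _ _ fmax); exact: nbhs_singleton ff1.
have f1p : \forall h \near 0^'+, 0 < h^-1 * (f1 (x + h) - f1 x).
  apply: (cvgr_gt q) => //.
  apply: cvg_trans (is_derive_quotient _ _ _ f1q); apply: cvg_app.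
  by apply: within_subset => h /= h0; rewrite gt_eqF.
move: ff1 fmax f1p; rewrite near_withinE => /nbhs_ballP[e1 /= e10 ff1].
move=> /nbhs_ballP[e2 /= e20 fmax] /nbhs_ballP[e3 /= e30 f1p].
have [e e0 /and3P[ee1 ee2 ee3]] : exists2 e : R, 0 < e & [&& e < e1, e < e2 & e < e3].
  pose m : R := Num.min e1 (Num.min e2 e3).
  have m0 : 0 < m by rewrite !lt_min e10 e20.
  have hm : m / 2 < m by rewrite ltr_pdivrMr// ltr_pMr// ltr1n.
  exists (m / 2); first by rewrite divr_gt0.
  by move: hm; rewrite {2}/m !lt_min.
have dfe y : y \in `[x, x + e] -> is_derive y 1 f (f1 y).
  rewrite in_itv/= => /andP[xy ye]; apply: ff1.
  by rewrite /ball/= distrC ger0_norm ?subr_ge0// ltrBlDl (le_lt_trans ye)// ltrD2l.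
have xe : x < x + e by rewrite ltrDl.
have dfo y : y \in `]x, x + e[ -> is_derive y 1 f (f1 y).
  by move=> /subset_itv_oo_cc /dfe.
have cf : {within `[x, x + e], continuous f}.
  by apply: derivable_within_continuous => y /dfe[].
have [c + fE] := MVT xe dfo cf.
rewrite in_itv/= => /andP[xc ce].
have := fmax (x + e); rewrite /ball/= opprD addrA subrr add0r normrN gtr0_norm//.
move=> /(_ ee2); rewrite -subr_le0 fE addrC addKr pmulr_lle0//.
apply/negP; rewrite -ltNge.
have := f1p (c - x); rewrite /ball/= sub0r normrN gtr0_norm ?subr_gt0//.
rewrite (addrC x) subrK f1x subr0.
rewrite pmulr_rgt0 ?invr_gt0 ?subr_gt0//; apply => //.
by rewrite ltrBlDr addrC (lt_trans ce)// ltrD2l.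
Qed.

Lemma near_lt (a x : R) : a < x -> \forall y \near x, a < y.
Proof.
move=> ax; have : x \in `]a, +oo[ by rewrite in_itv/= ax.
by move=> /near_in_itvoy; apply: filterS => y; rewrite in_itv/= andbT.
Qed.

Lemma continuous_pair (T U V : topologicalType) (f : T -> U) (g : T -> V) :
  continuous f -> continuous g -> continuous (fun p => (f p, g p)).
Proof. by move=> cf cg p; exact: (cvg_pair (cf p) (cg p)). Qed.

Lemma within_continuous_comp_sub (T U : topologicalType) (A : set T)
    (B : set U) (f : U -> R) (phi : T -> U) :
  continuous phi -> (forall p, A p -> B (phi p)) ->
  {within B, continuous f} -> {within A, continuous (fun p => f (phi p))}.
Proof.
move=> cphi AB /subspace_continuousP cf; apply/subspace_continuousP => p Ap V.
move=> /(cf _ (AB _ Ap)) /= h.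
have {}h : \forall q \near phi p, B q -> V (f q) by exact: h.
have {}h : \forall q \near p, B (phi q) -> V (f (phi q)) by exact: (cphi p _ h).
suff : \forall q \near p, A q -> V (f (phi q)) by [].
by apply: filterS h => q /= h Aq; apply/h/AB.
Qed.

Lemma within_continuous_section (F : R -> R -> R) t : 0 < t ->
  {within [set z | 0 <= z.1 /\ 0 < z.2], continuous (fun z : R * R => F z.1 z.2)} ->
  {within [set x | 0 <= x], continuous (F^~ t)}.
Proof.
move=> t0 cF.
apply: (@within_continuous_comp_sub _ _ _ _ (fun z => F z.1 z.2)
  (fun x => (x, t)) _ _ cF) => //.
by apply: continuous_pair => [x|x]; [exact: cvg_id|exact: cvg_cst].
Qed.

Lemma within_continuous_cvg_right f :
  {within [set x | 0 <= x], continuous f} -> f x @[x --> 0^'+] --> f 0.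
Proof.
move=> /subspace_continuousP /(_ 0 (lexx _)); apply: cvg_trans.
by apply: cvg_app; apply: within_subset => x /=; exact: ltW.
Qed.

End Calculus.

(* [notypeclasses]: otherwise the library's [is_derive] instances are tried on
   the premises and produce unusable terms. *)
Ltac derive_step := first
  [ eassumption
  | notypeclasses refine (is_derive_fcst _ _ _)
  | notypeclasses refine (is_derive_fid _ _)
  | notypeclasses refine (is_derive_fexp _ _ _ _ _)
  | notypeclasses refine (is_derive_fsqr _ _ _ _ _)
  | notypeclasses refine (is_derive_fN _ _ _ _ _)
  | notypeclasses refine (is_derive_fD _ _ _ _ _ _ _ _)
  | notypeclasses refine (is_derive_fM _ _ _ _ _ _ _ _) ].

Ltac derive := notypeclasses refine (is_derive_eq _ _); [ repeat derive_step | cbv beta ].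

(** * Maximum principles *)

Section MaximumPrinciple.
Variable R : realType.

(** A positive maximum over the compact rectangle cannot lie on the parabolic boundary. At such a
    point [v1 x = 0], [q <= 0], and [r >= 0] because earlier times are available even when [t = T];
    this contradicts [r < 0]. *)
Lemma rectangle_max_principle (a b s T : R) (v : R -> R -> R) :
  a <= b -> s <= T ->
  {within `[a, b] `*` `[s, T], continuous (fun z : R * R => v z.1 z.2)} ->
  (forall x, a <= x <= b -> v x s <= 0) ->
  (forall t, s <= t <= T -> v a t <= 0) ->
  (forall t, s <= t <= T -> v b t <= 0) ->
  (forall x t, a < x < b -> s < t <= T -> 0 < v x t ->
    exists (v1 : R -> R) (r q : R),
      [/\ is_derive t 1 (v x) r,
          \forall y \near x, is_derive (y : R) (1 : R) (v^~ t) (v1 y),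
          is_derive x 1 v1 q
        & v1 x = 0 -> q <= 0 -> r < 0]) ->
  forall x t, a <= x <= b -> s <= t <= T -> v x t <= 0.
Proof.
move=> ab sT cv vs va vb vint x0 t0 x0ab t0sT.
have K0 : `[a, b] `*` `[s, T] !=set0 by exists (a, s); rewrite /= !in_itv/= !lexx ab.
have cK : compact (`[a, b] `*` `[s, T]) by apply: compact_setX; exact: segment_compact.
have [[x t]] := compact_EVT_max K0 cK cv.
rewrite inE/= !in_itv/= => -[/andP[ax xb] /andP[st tT]] vmax.
have {}vmax y r : a <= y <= b -> s <= r <= T -> v y r <= v x t.
  by move=> yab rsT; apply: (vmax (y, r)); rewrite inE/= !in_itv.
apply: (le_trans (vmax _ _ x0ab t0sT)); rewrite leNgt; apply/negP => vxt.
have ax' : a < x.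
  rewrite lt_neqAle ax andbT; apply/eqP => E; move: vxt; rewrite -E.
  by apply/negP; rewrite -leNgt va// st.
have xb' : x < b.
  rewrite lt_neqAle xb andbT; apply/eqP => E; move: vxt; rewrite E.
  by apply/negP; rewrite -leNgt vb// st.
have st' : s < t.
  rewrite lt_neqAle st andbT; apply/eqP => E; move: vxt; rewrite -E.
  by apply/negP; rewrite -leNgt vs// ax.
have [||v1 [r [q [vr vv1 v1q]]]] := vint x t _ _ vxt; [by rewrite ax'|by rewrite st'|].
have maxx : \forall y \near x, v y t <= v x t.
  have : x \in `]a, b[ by rewrite in_itv/= ax'.
  move=> /near_in_itvoo; apply: filterS => y; rewrite in_itv/= => /andP[ay yb].
  by apply: vmax; [rewrite !ltW|rewrite st].
have v1x : v1 x = 0 by apply: (derive_eq0_max _ _ _ _ _ maxx); exact: nbhs_singleton vv1.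
have q0 : q <= 0 by exact: (derive2_le0_max _ _ _ _ _ vv1 v1q maxx).
move=> /(_ v1x q0); apply/negP; rewrite -leNgt.
apply: (derive_ge0_left_max _ _ _ _ vr); near=> y; apply: vmax; first by rewrite ax.
apply/andP; split; first by apply/ltW; near: y; exact: nbhs_left_gt.
by apply: le_trans tT; near: y; exact: nbhs_left_le.
Unshelve. all: by end_near. Qed.

(* The maximum principle for [E (c + z) t - E (c - z) t - b z c t], i.e. with
   the spatial variable of a one-dimensional problem doubled. *)
Lemma doubling_max_principle (r x0 s T : R) (E Ex Exx Et : R -> R -> R)
    (A B : R) :
  0 < r -> r < x0 / 2 -> 0 < s -> s <= T ->
  {within [set z | 0 <= z.1 /\ 0 < z.2], continuous (fun z : R * R => E z.1 z.2)} ->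
  (forall x t : R, 0 < x -> 0 < t -> is_derive x 1 (E^~ t) (Ex x t)) ->
  (forall x t : R, 0 < x -> 0 < t -> is_derive x 1 (Ex^~ t) (Exx x t)) ->
  (forall x t : R, 0 < x -> 0 < t -> is_derive t 1 (E x) (Et x t)) ->
  let v z c t := E (c + z) t - E (c - z) t
    - (A * (2 * r * z - z ^+ 2) + B * (c - x0) ^+ 2 + B * (T - t)) in
  (forall z c, 0 <= z <= r -> x0 - r <= c <= x0 + r -> v z c s <= 0) ->
  (forall c t, x0 - r <= c <= x0 + r -> s <= t <= T -> v 0 c t <= 0) ->
  (forall c t, x0 - r <= c <= x0 + r -> s <= t <= T -> v r c t <= 0) ->
  (forall z t, 0 <= z <= r -> s <= t <= T -> v z (x0 - r) t <= 0) ->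
  (forall z t, 0 <= z <= r -> s <= t <= T -> v z (x0 + r) t <= 0) ->
  (forall z c t : R, 0 < z < r -> x0 - r < c < x0 + r -> s < t <= T ->
     Ex (c + z) t + Ex (c - z) t = A * (2 * r - 2 * z) ->
     Ex (c + z) t - Ex (c - z) t = 2 * B * (c - x0) ->
     Exx (c + z) t - Exx (c - z) t <= - 2 * A ->
     Et (c + z) t - Et (c - z) t + B < 0) ->
  forall z c t, 0 <= z <= r -> x0 - r <= c <= x0 + r -> s <= t <= T ->
  v z c t <= 0.
Proof.
move=> r0 rx0 s0 sT cE hx hxx ht v vs v0 vr va vb vint z1 c1 t1 z1r c1x t1s.
pose K : set (R * R * R) := (`[0, r] `*` `[x0 - r, x0 + r]) `*` `[s, T].
have x0r : x0 - r <= x0 + r by lra.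
have K0 : K !=set0.
  by exists (0, x0 - r, s); rewrite /K/= !in_itv/= !lexx x0r (ltW r0).
have cK : compact K by do 2! (apply: compact_setX; last exact: segment_compact); exact: segment_compact.
have cv : {within K, continuous (fun p : R * R * R => v p.1.1 p.1.2 p.2)}.
  have k1 : continuous (fun p : R * R * R => p.1.1).
    by move=> p; apply: (@cvg_comp _ _ _ fst fst); apply: cvg_fst.
  have k2 : continuous (fun p : R * R * R => p.1.2).
    by move=> p; apply: (@cvg_comp _ _ _ fst snd); [apply: cvg_fst|apply: cvg_snd].
  have k3 : continuous (fun p : R * R * R => p.2) by move=> p; apply: cvg_snd.
  have cP : {within K, continuous (fun p : R * R * R => E (p.1.2 + p.1.1) p.2)}.
    apply: (@within_continuous_comp_sub _ _ _ _ _ (fun z => E z.1 z.2)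
      (fun p : R * R * R => (p.1.2 + p.1.1, p.2)) _ _ cE) => [|p].
      by apply: continuous_pair k3 => p; apply: cvgD; [exact: k2|exact: k1].
    rewrite /K/= !in_itv/= => -[[/andP[? ?] /andP[? ?]] /andP[? ?]]; lra.
  have cM : {within K, continuous (fun p : R * R * R => E (p.1.2 - p.1.1) p.2)}.
    apply: (@within_continuous_comp_sub _ _ _ _ _ (fun z => E z.1 z.2)
      (fun p : R * R * R => (p.1.2 - p.1.1, p.2)) _ _ cE) => [|p].
      by apply: continuous_pair k3 => p; apply: cvgB; [exact: k2|exact: k1].
    rewrite /K/= !in_itv/= => -[[/andP[? ?] /andP[? ?]] /andP[? ?]]; lra.
  have kb : {within K, continuous (fun p : R * R * R =>
     A * (2 * r * p.1.1 - p.1.1 ^+ 2) + B * (p.1.2 - x0) ^+ 2 + B * (T - p.2))}.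
    apply: continuous_subspaceT => p.
    apply: cvgD; first apply: cvgD.
    - apply: cvgM; first exact: cvg_cst.
      by apply: cvgB; apply: cvgM; [exact: cvg_cst|exact: k1..].
    - apply: cvgM; first exact: cvg_cst.
      by apply: cvgM; apply: cvgB; [exact: k2|exact: cvg_cst|exact: k2|exact: cvg_cst].
    - by apply: cvgM; [exact: cvg_cst|apply: cvgB; [exact: cvg_cst|exact: k3]].
  by move=> p; apply: cvgB; [apply: cvgB; [exact: cP|exact: cM]|exact: kb].
have [[[z c] t]] := compact_EVT_max K0 cK cv.
rewrite inE /K/= !in_itv/= => -[[/andP[z0 zr] /andP[ac cb]] /andP[st tT]] vmax.
have {}vmax y d u : 0 <= y <= r -> x0 - r <= d <= x0 + r -> s <= u <= T ->
    v y d u <= v z c t.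
  by move=> yab dab usT; apply: (vmax (y, d, u)); rewrite inE /K/= !in_itv.
apply: (le_trans (vmax _ _ _ z1r c1x t1s)); rewrite leNgt; apply/negP => vp.
have z0' : 0 < z.
  rewrite lt_neqAle z0 andbT; apply/eqP => Z; move: vp; rewrite -Z.
  by apply/negP; rewrite -leNgt v0 ?ac ?st.
have zr' : z < r.
  rewrite lt_neqAle zr andbT; apply/eqP => Z; move: vp; rewrite Z.
  by apply/negP; rewrite -leNgt vr ?ac ?st.
have ac' : x0 - r < c.
  rewrite lt_neqAle ac andbT; apply/eqP => Z; move: vp; rewrite -Z.
  by apply/negP; rewrite -leNgt va ?z0 ?st.
have cb' : c < x0 + r.
  rewrite lt_neqAle cb andbT; apply/eqP => Z; move: vp; rewrite Z.
  by apply/negP; rewrite -leNgt vb ?z0 ?st.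
have st' : s < t.
  rewrite lt_neqAle st andbT; apply/eqP => Z; move: vp; rewrite -Z.
  by apply/negP; rewrite -leNgt vs ?z0 ?ac.
have t0 : 0 < t by exact: lt_trans st'.
(* [d - y >= x0 - 2 * r], which is positive because [r < x0 / 2]. *)
have cz (y d : R) : 0 <= y <= r -> x0 - r <= d <= x0 + r -> 0 < d + y /\ 0 < d - y.
  by move=> /andP[? ?] /andP[? ?]; split; lra.
have [czp czm] := cz z c ltac:(by rewrite z0) ltac:(by rewrite ac).
pose f1 y := Ex (c + y) t + Ex (c - y) t - A * (2 * r - 2 * y).
have vf1 y : 0 <= y <= r -> is_derive y 1 (fun y => v y c t) (f1 y).
  move=> yr'; have [yp ym] := cz y c yr' ltac:(by rewrite ac).
  have d1 := is_derive_faddl _ _ _ _ _ (hx _ _ yp t0).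
  have d2 := is_derive_fsubl _ _ _ _ _ (hx _ _ ym t0).
  by rewrite /v; derive; rewrite /f1; ring.
have f1q : is_derive z 1 f1 (Exx (c + z) t - Exx (c - z) t + 2 * A).
  have d1 := is_derive_faddl _ _ _ _ _ (hxx _ _ czp t0).
  have d2 := is_derive_fsubl _ _ _ _ _ (hxx _ _ czm t0).
  by rewrite /f1; derive; ring.
have vg : is_derive c 1 (fun d => v z d t)
    (Ex (c + z) t - Ex (c - z) t - 2 * B * (c - x0)).
  have d1 := is_derive_faddr _ _ _ _ _ (hx _ _ czp t0).
  have d2 := is_derive_faddr _ _ _ _ _ (hx _ _ czm t0).
  by rewrite /v; derive; ring.
have vt : is_derive t 1 (v z c) (Et (c + z) t - Et (c - z) t + B).
  have d1 := ht _ _ czp t0; have d2 := ht _ _ czm t0.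
  by rewrite /v; derive; ring.
have nearz : \forall y \near z, y \in `]0, r[ by apply: near_in_itvoo; rewrite in_itv/= z0'.
have maxz : \forall y \near z, v y c t <= v z c t.
  apply: filterS nearz => y; rewrite in_itv/= => /andP[y0 yr].
  by apply: vmax; [rewrite !ltW|rewrite ac|rewrite st].
have f1z : f1 z = 0.
  by apply: (derive_eq0_max _ _ _ _ _ maxz); apply: vf1; rewrite z0.
have nearf1 : \forall y \near z, is_derive (y : R) (1 : R) (fun y => v y c t) (f1 y).
  by apply: filterS nearz => y; rewrite in_itv/= => /andP[y0 yr]; apply: vf1; rewrite !ltW.
have := derive2_le0_max _ _ _ _ _ nearf1 f1q maxz.
have g0 : Ex (c + z) t - Ex (c - z) t - 2 * B * (c - x0) = 0.
  apply: (derive_eq0_max _ _ _ _ vg).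
  have : c \in `]x0 - r, x0 + r[ by rewrite in_itv/= ac'.
  move=> /near_in_itvoo; apply: filterS => y; rewrite in_itv/= => /andP[y0 yr].
  by apply: vmax; [rewrite z0|rewrite !ltW|rewrite st].
(* The first order conditions in [z] and [c] and the second order one in [z] are the premises of
   [vint]; its conclusion contradicts maximality with respect to earlier times. *)
move=> q0.
have := vint z c t; rewrite z0' zr' ac' cb' st' tT => /(_ isT isT isT).
have -> : Et (c + z) t - Et (c - z) t + B < 0 = false.
  apply/negbTE; rewrite -leNgt; apply: (derive_ge0_left_max _ _ _ _ vt); near=> y.
  apply: vmax; rewrite ?z0 ?ac//; apply/andP; split.
    by apply/ltW; near: y; exact: nbhs_left_gt.
  by apply: le_trans tT; near: y; exact: nbhs_left_le.
move=> vint'; suff : false by []; apply: vint'.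
- by apply/eqP; rewrite -subr_eq0; apply/eqP.
- by apply/eqP; rewrite -subr_eq0; apply/eqP.
- by rewrite mulNr -subr_le0 opprK.
Unshelve. all: by end_near. Qed.

End MaximumPrinciple.

(** * The equation for the primitive *)

(** For [s = sigma ^+ 2 / 2] this is the stationary density up to a factor. It is also an
    eigenfunction, with eigenvalue [- alpha], of the operator [s E_xx + alpha (x - beta) E_x]. *)
Definition ou_weight {R : realType} (alpha beta s x : R) : R :=
  expR (- (alpha / (2 * s) * (x - beta) ^+ 2)).

Section Outward.
Variable R : realType.
Variables (alpha beta s : R).
Hypotheses (alpha0 : 0 < alpha) (s0 : 0 < s).

(** Read as a backward equation, it has the drift [alpha (x - beta)], pointing away from [beta],
    contrary to the drift of the process. [Ex] is an argument so that its boundary value [Ex 0 t] is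
    available. *)
Record outward_solution (E Ex Exx : R -> R -> R) : Prop := {
  os_cont : {within [set z | 0 <= z.1 /\ 0 < z.2],
    continuous (fun z : R * R => E z.1 z.2)} ;
  os_contx : {within [set z | 0 <= z.1 /\ 0 < z.2],
    continuous (fun z : R * R => Ex z.1 z.2)} ;
  os_dx : forall x t : R, 0 < x -> 0 < t -> is_derive x 1 (E^~ t) (Ex x t) ;
  os_dxx : forall x t : R, 0 < x -> 0 < t -> is_derive x 1 (Ex^~ t) (Exx x t) ;
  os_dt : forall x t : R, 0 < x -> 0 < t ->
    is_derive t 1 (E x) (s * Exx x t + alpha * (x - beta) * Ex x t) ;
  os_dirichlet : forall t, 0 < t -> E 0 t = 0
}.

Lemma outward_solutionN E Ex Exx : outward_solution E Ex Exx ->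
  outward_solution (fun x t => - E x t) (fun x t => - Ex x t)
    (fun x t => - Exx x t).
Proof.
case=> cE cEx dx dxx dt E0; split => [| |x t x0 t0|x t x0 t0|x t x0 t0|t t0].
- by move=> z; apply: cvgN; exact: cE.
- by move=> z; apply: cvgN; exact: cEx.
- exact/is_derive_fN/dx.
- exact/is_derive_fN/dxx.
- have d := dt x t x0 t0; derive; ring.
- by rewrite E0 ?oppr0.
Qed.

Local Notation w0 := (ou_weight alpha beta s).
Let w0x (x : R) : R := - (alpha / s * (x - beta)) * w0 x.
Let w0xx (x : R) : R := ((alpha / s * (x - beta)) ^+ 2 - alpha / s) * w0 x.

Let dw0 (x : R) : is_derive x 1 w0 (w0x x).
Proof. by rewrite /ou_weight; derive; rewrite /w0x /ou_weight; field; rewrite gt_eqF. Qed.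

Let dw0x (x : R) : is_derive x 1 w0x (w0xx x).
Proof.
have d := dw0 x.
by rewrite /w0x; derive; rewrite /w0x /w0xx; field; rewrite gt_eqF.
Qed.

(** Comparison with a constant plus a decaying eigenmode: this is an exact solution, nonnegative at
    the origin, where [E] vanishes. *)
Lemma outward_decay_tail E Ex Exx : outward_solution E Ex Exx ->
  (forall x t, 0 <= x -> 0 < t -> E x t <= 1) ->
  forall h C : R, 0 <= h -> 0 <= C -> (forall x, 0 <= x -> E x 1 <= h + C * w0 x) ->
  forall x t : R, 0 <= x -> 1 <= t ->
    E x t <= h + C * w0 x * expR (- (alpha * (t - 1))).
Proof.
move=> sE E1 h C h0 C0 Eh x1 t1 x10 t11.
(* [m] and [m + beta] are positive, which makes [(x + m) * expR (2 * alpha * t)] a positive strict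
   supersolution: [2 * (x + m) > x - beta]. *)
pose m : R := 1 + `|beta|.
have mb : 0 < m + beta.
  by rewrite /m -addrA ltr_pwDl// -lerBlDr sub0r -normrN ler_norm.
have mb' : 0 < m - beta by rewrite /m -addrA ltr_pwDl// subr_ge0 ler_norm.
have m0 : 0 < m by rewrite /m ltr_pwDl.
clearbody m.
apply/ler_addgt0Pr => e e0.
pose k : R := (x1 + m) * expR (2 * alpha * t1).
have k0 : 0 < k by rewrite mulr_gt0 ?expR_gt0// ltr_wpDl.
pose eps : R := e / k; have eps0 : 0 < eps by rewrite divr_gt0.
pose X : R := x1 + eps^-1.
have X0 : 0 <= X by rewrite addr_ge0// invr_ge0 ltW.
(* The [eps] term is a supersolution exceeding 1 at [X]: it dispenses with any
   decay of [E] at infinity that would be uniform in time. *)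
pose v x t := E x t - (h + C * w0 x * expR (- (alpha * (t - 1)))
  + eps * (x + m) * expR (2 * alpha * t)).
have w00 x : 0 < w0 x by exact: expR_gt0.
suff : v x1 t1 <= 0.
  rewrite /v subr_le0 => /le_trans; apply; rewrite lerD2l.
  by rewrite /eps -mulrA -/k divfK// gt_eqF.
have barrier_ge0 x t : 0 <= x ->
    0 <= h + C * w0 x * expR (- (alpha * (t - 1))) /\
    0 <= eps * (x + m) * expR (2 * alpha * t).
  move=> x0; split; first by rewrite addr_ge0// mulr_ge0 ?expR_ge0// mulr_ge0// ltW.
  by rewrite mulr_ge0 ?expR_ge0// mulr_ge0 ?(ltW eps0)// addr_ge0// ltW.
apply: (@rectangle_max_principle R 0 X 1 t1 v) => //.
- move=> z; apply: cvgB.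
    move: z; apply: continuous_subspaceW (os_cont _ _ _ sE).
    by move=> [x t]/=; rewrite !in_itv/= => -[/andP[? _] /andP[? _]]; split => //; lra.
  move: z; apply: continuous_subspaceT => z.
  have c1 : continuous (fun p : R * R => p.1) by move=> p; exact: cvg_fst.
  have c2 : continuous (fun p : R * R => p.2) by move=> p; exact: cvg_snd.
  have ce (f : R * R -> R) : continuous f -> continuous (fun p => expR (f p)).
    by move=> cf p; apply: continuous_comp; [exact: cf|exact: continuous_expR].
  apply: cvgD; first apply: cvgD; first exact: cvg_cst.
    apply: cvgM; first apply: cvgM; first exact: cvg_cst.
      apply: (ce (fun p => - (alpha / (2 * s) * (p.1 - beta) ^+ 2))) => p.
      apply: cvgN; apply: cvgM; first exact: cvg_cst.
      by apply: cvgM; apply: cvgB; [exact: c1|exact: cvg_cst|exact: c1|exact: cvg_cst].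
    apply: (ce (fun p => - (alpha * (p.2 - 1)))) => p.
    by apply: cvgN; apply: cvgM; [exact: cvg_cst|apply: cvgB; [exact: c2|exact: cvg_cst]].
  apply: cvgM; first apply: cvgM; first exact: cvg_cst.
    by apply: cvgD; [exact: c1|exact: cvg_cst].
  apply: (ce (fun p => 2 * alpha * p.2)) => p.
  by apply: cvgM; [exact: cvg_cst|exact: c2].
- move=> x /andP[x0 _]; rewrite /v subr_le0 (le_trans (Eh _ x0))//.
  by rewrite subrr mulr0 oppr0 expR0 [_ * w0 x * 1]mulr1 lerDl; have [] := barrier_ge0 x 1 x0.
- move=> t /andP[t0 _]; rewrite /v (os_dirichlet _ _ _ sE) ?(lt_le_trans _ t0)//.
  by rewrite sub0r oppr_le0; have [] := barrier_ge0 0 t (lexx _); exact: addr_ge0.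
- move=> t /andP[t0 _]; rewrite /v subr_le0.
  have t0' : 0 < t by exact: lt_le_trans t0.
  apply: (le_trans (E1 _ _ X0 t0')).
  have [b1 _] := barrier_ge0 X t X0; apply: (ler_wpDl b1).
  have e1 : 1 <= expR (2 * alpha * t) by rewrite -expR0 ler_expR !mulr_ge0// ltW.
  have X1 : 1 <= eps * (X + m).
    rewrite /X !mulrDr mulfV ?gt_eqF// addrAC lerDr addr_ge0//.
      by rewrite mulr_ge0// ltW.
    by rewrite mulr_ge0// ltW.
  by rewrite (le_trans X1)// ler_peMr// (le_trans ler01).
- move=> x t /andP[x0 _] /andP[t0 _] _.
  have {}t0 : 0 < t by exact: lt_trans t0.
  have dx (y : R) : 0 < y -> is_derive y 1 (v^~ t) (Ex y t - (C * w0x y * expR (- (alpha * (t - 1))) + eps * expR (2 * alpha * t))).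
    move=> y0; have d1 := os_dx _ _ _ sE y t y0 t0; have d2 := dw0 y.
    by rewrite /v; derive; ring.
  exists (fun y => Ex y t - (C * w0x y * expR (- (alpha * (t - 1))) + eps * expR (2 * alpha * t))).
  exists (s * Exx x t + alpha * (x - beta) * Ex x t + alpha * C * w0 x * expR (- (alpha * (t - 1))) - 2 * alpha * eps * (x + m) * expR (2 * alpha * t)).
  exists (Exx x t - C * w0xx x * expR (- (alpha * (t - 1)))).
  split.
  + have d1 := os_dt _ _ _ sE x t x0 t0.
    by rewrite /v; derive; ring.
  + by apply: filterS (near_lt _ _ _ x0) => y; exact: dx.
  + have d1 := os_dxx _ _ _ sE x t x0 t0; have d2 := dw0x x.
    by derive; ring.
  + move=> /eqP; rewrite subr_eq0 => /eqP ->.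
    rewrite subr_le0 => Exxle.
    have : s * Exx x t <= s * (C * w0xx x * expR (- (alpha * (t - 1)))) by rewrite ler_pM2l.
    (* The eigenvalue relation [s w0'' + alpha (x - beta) w0' = - alpha w0]. *)
    have -> : s * (C * w0xx x * expR (- (alpha * (t - 1)))) =
       - (alpha * (x - beta) * (C * w0x x * expR (- (alpha * (t - 1)))))
       - alpha * C * w0 x * expR (- (alpha * (t - 1))).
      by rewrite /w0xx /w0x; field; rewrite gt_eqF.
    have : 0 < alpha * eps * expR (2 * alpha * t) * (x + (m + beta) + m).
      have p : 0 < x + (m + beta) + m by rewrite addr_gt0// addr_gt0.
      by rewrite mulr_gt0// mulr_gt0 ?expR_gt0// mulr_gt0.
    set e' := expR (2 * alpha * t); set e1 := expR _; move: (w0x x) (w0 x).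
    by move: (Exx x t) => Q W1 W2 hh1 hh2; lra.
- by rewrite x10 /X lerDl invr_ge0 ltW.
- by rewrite t11 lexx.
Qed.

(** Beyond some [X] the value at time 1 is below [h / 2], and on [[0, X]] a large multiple of the
    Gaussian dominates it; that multiple then decays in time, uniformly in [x]. *)
Lemma outward_decay E Ex Exx : outward_solution E Ex Exx ->
  (forall x t, 0 <= x -> 0 < t -> E x t <= 1) ->
  (E x 1 @[x --> +oo] --> 0) ->
  forall h : R, 0 < h ->
    exists2 T : R, 1 <= T & forall x t, 0 <= x -> T <= t -> E x t <= h.
Proof.
move=> sE E1 Ey h h0.
have [X X0 EX] : exists2 X : R, 0 <= X & forall x, X < x -> E x 1 < h / 2.
  have h2 : 0 < h / 2 by rewrite divr_gt0.
  have [M [_ HM]] : \forall x \near +oo, E x 1 < h / 2 by exact: (cvgr_lt _ Ey).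
  exists (Num.max 0 M); first by rewrite le_max lexx.
  by move=> x; rewrite gt_max => /andP[_]; exact: HM.
(* [C * w0 x >= 1] on [[0, X]], because there [|x - beta| <= X + |beta|]. *)
pose C : R := expR (alpha / (2 * s) * (X + `|beta|) ^+ 2).
have k0 : 0 <= alpha / (2 * s) by rewrite divr_ge0 ?mulr_ge0// ltW.
have C0 : 0 < C by exact: expR_gt0.
have EC x : 0 <= x -> E x 1 <= h / 2 + C * w0 x.
  move=> x0; have [xX|/EX Ex1] := leP x X; last first.
    by rewrite (le_trans (ltW Ex1))// lerDl mulr_ge0 ?expR_ge0// ltW.
  apply: ler_wpDl; first by rewrite divr_ge0// ltW.
  apply: (le_trans (E1 _ _ x0 ltr01)); rewrite /C /ou_weight -expRD -[leLHS]expR0 ler_expR.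
  rewrite subr_ge0; apply: ler_wpM2l => //.
  rewrite -[leLHS]real_normK ?num_real//.
  rewrite ler_sqr ?nnegrE ?addr_ge0//.
  by rewrite (le_trans (ler_normB _ _))// lerD2r ger0_norm.
(* From this time on [alpha * (t - 1) >= 2 * C / h], and [expR y >= 1 + y] brings the Gaussian term
   below [h / 2]. *)
exists (1 + 2 * C / (h * alpha)).
  by rewrite lerDl divr_ge0 ?mulr_ge0// ltW.
move=> x t x0 tT.
have t1 : 1 <= t by rewrite (le_trans _ tT)// lerDl divr_ge0 ?mulr_ge0// ltW.
have h2 : 0 <= h / 2 by rewrite divr_ge0// ltW.
have := outward_decay_tail _ _ _ sE E1 _ _ h2 (ltW C0) EC _ _ x0 t1.
move=> /le_trans; apply; rewrite [leRHS]splitr lerD2l.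
have w1 : w0 x <= 1.
  by rewrite -[leRHS]expR0 ler_expR oppr_le0 mulr_ge0// sqr_ge0.
apply: (@le_trans _ _ (C * expR (- (alpha * (t - 1))))).
  by rewrite ler_wpM2r ?expR_ge0// ler_piMr// ltW.
rewrite expRN ler_pdivrMr ?expR_gt0//.
have := expR_ge1Dx (alpha * (t - 1)).
have at1 : 2 * C / h <= alpha * (t - 1).
  move: tT; rewrite -lerBrDl ler_pdivrMr ?mulr_gt0// => tT.
  by rewrite ler_pdivrMr//; lra.
move=> /(le_trans (lerD (lexx 1) at1)) => eb.
have {}eb : 2 * C / h <= expR (alpha * (t - 1)) by apply: le_trans eb; rewrite lerDr.
by move: eb; rewrite ler_pdivrMr// => eb; lra.
Qed.

(** On [[0, r]], over the last unit of time, [E] stays below [d] times the barrier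
    [A (2 r x - x^2) + (t - u)], which at time [t] vanishes at the origin with slope [2 A r]. The
    constant depends on the coefficients only, so a small [E] has a small slope. *)
Lemma boundary_gradient_bound : exists2 K : R, 0 <= K &
  forall E Ex Exx, outward_solution E Ex Exx ->
  forall d t : R, 0 < d -> 1 < t ->
  (forall x u, 0 <= x -> t - 1 <= u <= t -> E x u <= d) ->
  Ex 0 t <= K * d.
Proof.
(* [r] is so small that on [[0, r]] the drift costs at most half of the diffusion; this is [rs]. *)
pose r : R := Num.min 1 (s / (2 * alpha * (1 + `|beta|))).
have b1 : 0 < 1 + `|beta| by rewrite ltr_pwDl.
have r0 : 0 < r by rewrite lt_min ltr01/= divr_gt0// !mulr_gt0.
have r1 : r <= 1 by rewrite ge_min lexx.
have rs : alpha * ((r + `|beta|) * r) <= s / 2.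
  have rs' : r <= s / (2 * alpha * (1 + `|beta|)) by rewrite ge_min lexx orbT.
  apply: (@le_trans _ _ (alpha * ((1 + `|beta|) * r))).
    by rewrite ler_pM2l// ler_pM2r// lerD2r.
  move: rs'; rewrite ler_pdivlMr ?mulr_gt0// => rs'.
  by rewrite ler_pdivlMr//; lra.
(* The term [2 / s] absorbs the unit source coming from [t - u]; the term [1 / r^2] lifts the
   barrier to [d] at [x = r]. *)
pose A : R := 2 / s + (r ^+ 2)^-1.
have A0 : 0 < A by rewrite addr_gt0 ?divr_gt0// invr_gt0 exprn_gt0.
exists (2 * A * r); first by rewrite !mulr_ge0// ltW.
move=> E Ex Exx sE d t d0 t1 Ed.
pose v x u := E x u - d * (A * (2 * r * x - x ^+ 2) + (t - u)).
have vle x : 0 <= x <= r -> v x t <= 0.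
  move=> xr; apply: (@rectangle_max_principle R 0 r (t - 1) t v) => //.
  - exact: ltW.
  - by rewrite gerBl.
  - move=> z; apply: cvgB.
      move: z; apply: continuous_subspaceW (os_cont _ _ _ sE).
      by move=> [y u]/=; rewrite !in_itv/= => -[/andP[? _] /andP[? _]]; split => //; lra.
    move: z; apply: continuous_subspaceT => z.
    have c1 : continuous (fun p : R * R => p.1) by move=> p; exact: cvg_fst.
    have c2 : continuous (fun p : R * R => p.2) by move=> p; exact: cvg_snd.
    apply: cvgM; first exact: cvg_cst.
    apply: cvgD; last by apply: cvgB; [exact: cvg_cst|exact: c2].
    apply: cvgM; first exact: cvg_cst.
    by apply: cvgB; apply: cvgM; [exact: cvg_cst|exact: c1..].
  - move=> y /andP[y0 yr]; rewrite /v subr_le0.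
    apply: (@le_trans _ _ d); first by rewrite Ed// lexx gerBl ler01.
    have -> : t - (t - 1) = 1 by ring.
    rewrite ler_peMr ?(ltW d0)// lerDr mulr_ge0 ?(ltW A0)//.
    have -> : 2 * r * y - y ^+ 2 = y * (2 * r - y) by ring.
    by rewrite mulr_ge0//; lra.
  - move=> u /andP[u1 ut]; rewrite /v (os_dirichlet _ _ _ sE); last by lra.
    by rewrite sub0r oppr_le0 mulr_ge0 ?(ltW d0)// mulr0 expr2 mulr0 subrr mulr0 add0r subr_ge0.
  - move=> u /andP[u1 ut]; rewrite /v subr_le0.
    apply: (@le_trans _ _ d); first by rewrite Ed ?(ltW r0)// u1.
    rewrite ler_peMr ?(ltW d0)//.
    have -> : 2 * r * r - r ^+ 2 = r ^+ 2 by ring.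
    apply: ler_wpDr; first by rewrite subr_ge0.
    rewrite /A mulrDl mulVf ?expf_neq0 ?gt_eqF// lerDr.
    by rewrite mulr_ge0 ?sqr_ge0// divr_ge0// ltW.
  - move=> y u /andP[y0 yr] /andP[tu ut] _.
    have u0 : 0 < u by lra.
    have dx (z : R) : 0 < z -> is_derive z 1 (v^~ u) (Ex z u - d * (A * (2 * r - 2 * z))).
      move=> z0; have d1 := os_dx _ _ _ sE z u z0 u0.
      by rewrite /v; derive; ring.
    exists (fun z => Ex z u - d * (A * (2 * r - 2 * z))).
    exists (s * Exx y u + alpha * (y - beta) * Ex y u + d).
    exists (Exx y u + 2 * d * A); split.
    + have d1 := os_dt _ _ _ sE y u y0 u0.
      by rewrite /v; derive; ring.
    + by apply: filterS (near_lt _ _ _ y0) => z; exact: dx.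
    + have d1 := os_dxx _ _ _ sE y u y0 u0.
      by derive; ring.
    + move=> /eqP; rewrite subr_eq0 => /eqP -> Exxle.
      have h1 : s * Exx y u <= - (2 * s * d * A).
        have : s * (Exx y u + 2 * d * A) <= 0 by rewrite pmulr_rle0.
        by rewrite mulrDr; lra.
      have h2 : (y - beta) * (r - y) <= (r + `|beta|) * r.
        apply: (@le_trans _ _ ((r + `|beta|) * (r - y))).
          by rewrite ler_pM2r ?subr_gt0// lerD ?(ltW yr)// -normrN ler_norm.
        by rewrite ler_wpM2l ?gerBl ?(ltW y0)// addr_ge0// ltW.
      have h3 : alpha * ((y - beta) * (r - y)) <= s / 2.
        by apply: le_trans rs; rewrite ler_pM2l.
      have h4 : 2 <= A * s.
        by rewrite /A mulrDl divfK ?gt_eqF// lerDl mulr_ge0 ?invr_ge0 ?sqr_ge0// ltW.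
      have h5 : 2 * d * A * (alpha * ((y - beta) * (r - y))) <= 2 * d * A * (s / 2).
        by rewrite ler_pM2l// !mulr_gt0.
      have h6 : d * 2 <= d * (A * s) by rewrite ler_pM2l.
      by move: (Exx y u) h1 => Q h1; lra.
  - by rewrite lexx gerBl ler01.
have Ele x : 0 <= x <= r -> E x t <= d * A * (2 * r * x).
  move=> xr; have := vle x xr; rewrite /v subrr addr0 subr_le0 => /le_trans; apply.
  by rewrite mulrA ler_pM2l ?mulr_gt0// gerBl sqr_ge0.
(* A larger slope at the origin would persist nearby by continuity of [Ex], and the mean value
   theorem would contradict [Ele]. *)
rewrite leNgt; apply/negP => Kd.
have t0 : 0 < t by exact: lt_trans t1.
have cEx : Ex y t @[y --> 0^'+] --> Ex 0 t.
  apply: (within_continuous_cvg_right _ (Ex^~ t)).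
  exact: within_continuous_section (os_contx _ _ _ sE).
have : \forall y \near 0^'+, 2 * A * r * d < Ex y t by exact: (cvgr_gt _ cEx).
rewrite near_withinE => /nbhs_ballP[e /= e0 He].
pose z : R := Num.min r (e / 2).
have z0 : 0 < z by rewrite lt_min r0 divr_gt0.
have zr : z <= r by rewrite ge_min lexx.
have ze : z < e.
  by rewrite (@le_lt_trans _ _ (e / 2)) ?ge_min ?lexx ?orbT// ltr_pdivrMr// ltr_pMr// ltr1n.
have cE : {within `[0, z], continuous (E^~ t)}.
  apply: continuous_subspaceW (within_continuous_section _ _ _ t0 (os_cont _ _ _ sE)).
  by move=> y /=; rewrite in_itv/= => /andP[].
have dE (y : R) : y \in `]0, z[ -> is_derive y 1 (E^~ t) (Ex y t).
  by rewrite in_itv/= => /andP[y0 _]; exact: (os_dx _ _ _ sE).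
have [y + Ey] := MVT z0 dE cE.
rewrite in_itv/= => /andP[y0 yz].
move: Ey; rewrite subr0 (os_dirichlet _ _ _ sE)// subr0 => Ey.
have := Ele z; rewrite Ey zr (ltW z0) => /(_ isT).
have -> : d * A * (2 * r * z) = 2 * A * r * d * z by ring.
rewrite ler_pM2r//; apply/negP; rewrite -ltNge; apply: He => //.
by rewrite /ball/= sub0r normrN gtr0_norm// (lt_trans yz).
Qed.

End Outward.

(** * Gradient at interior points and its decay *)

Section OutwardGradient.
Variable R : realType.
Variables (alpha beta s : R).
Hypotheses (alpha0 : 0 < alpha) (s0 : 0 < s).

(** The increment [E (c + z) t - E (c - z) t] vanishes at [z = 0], which thus plays the part of the
    boundary in a barrier argument. The centre [c] varies as well, since the equation of the
    increment involves its derivative in [c]. *)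
Lemma interior_gradient_bound (x0 : R) : 0 < x0 -> exists2 K : R, 0 <= K &
  forall E Ex Exx, outward_solution R alpha beta s E Ex Exx ->
  forall d t : R, 0 < d -> 1 < t ->
  (forall x u, 0 <= x -> t - 1 <= u <= t -> `|E x u| <= d) ->
  Ex x0 t <= K * d.
Proof.
move=> x00.
(* [x0 / 3] keeps [c - z] positive; [1] and [s / alpha] give [alpha * r ^+ 2 <= s]. *)
pose r : R := Num.min (x0 / 3) (Num.min 1 (s / alpha)).
have r0 : 0 < r by rewrite !lt_min ltr01 !divr_gt0.
have rx0 : r < x0 / 2.
  by apply: (@le_lt_trans _ _ (x0 / 3)); [rewrite ge_min lexx|lra].
have r1 : r <= 1 by rewrite !ge_min lexx orbT.
have rs : alpha * r ^+ 2 <= s.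
  have rs' : r <= s / alpha by rewrite !ge_min lexx !orbT.
  move: rs'; rewrite ler_pdivlMr// => rs'.
  apply: le_trans rs'; rewrite mulrC ler_pM2r// expr2 ler_piMr//.
  exact: ltW.
pose M : R := (x0 + `|beta| + r) * r.
have M0 : 0 <= M by rewrite mulr_ge0 ?(ltW r0)// !addr_ge0// ltW.
(* The oscillation of [E] is at most [2 * d]. [B] makes the barrier reach it at [c = x0 - r], at
   [c = x0 + r] and at the initial time, [A] at [z = r]; the rest of [A] pays for the contribution
   of the [B] terms, as [As] records. *)
pose B : R := 2 + 2 / r ^+ 2.
have rr0 : 0 < r ^+ 2 by rewrite exprn_gt0.
have B0 : 0 < B by rewrite addr_gt0// divr_gt0.
pose A : R := 2 / r ^+ 2 + (B * (1 + 2 * alpha * M) + 1) / s.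
have A1 : 0 <= (B * (1 + 2 * alpha * M) + 1) / s.
  have p : 0 <= 1 + 2 * alpha * M by rewrite addr_ge0// mulr_ge0// mulr_ge0// ltW.
  by rewrite divr_ge0 ?(ltW s0)// addr_ge0// mulr_ge0// ltW.
have A2 : 0 < 2 / r ^+ 2 by rewrite divr_gt0.
have A0 : 0 < A by rewrite ltr_wpDr.
have As : B * (1 + 2 * alpha * M) < s * A.
  rewrite /A [ltRHS]mulrDr [s * (_ / s)]mulrCA divff ?gt_eqF// mulr1.
  by rewrite (@lt_trans _ _ (B * (1 + 2 * alpha * M) + 1)) ?ltrDl// ltrDr mulr_gt0.
have Ar : 2 <= A * r ^+ 2.
  by rewrite /A mulrDl divfK ?gt_eqF// lerDl mulr_ge0// ltW.
have Br : 2 <= B * r ^+ 2.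
  by rewrite /B mulrDl divfK ?gt_eqF// lerDr mulr_ge0// ltW.
have B2 : 2 <= B by rewrite lerDl ltW.
clearbody A B.
exists (A * r); first by rewrite mulr_ge0 ?ltW.
move=> E Ex Exx sE d t d0 t1 Ed.
have t0 : 0 < t by exact: lt_trans t1.
have EE x y u : 0 <= x -> 0 <= y -> t - 1 <= u <= t -> E x u - E y u <= 2 * d.
  move=> x0' y0 ut; have := Ed x u x0' ut; have := Ed y u y0 ut.
  by rewrite !ler_norml => /andP[? ?] /andP[? ?]; lra.
have psi0 z : 0 <= z <= r -> 0 <= 2 * r * z - z ^+ 2.
  move=> /andP[z0 zr]; have -> : 2 * r * z - z ^+ 2 = z * (2 * r - z) by ring.
  by rewrite mulr_ge0//; lra.
have dbl z : 0 <= z <= r ->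
    E (x0 + z) t - E (x0 - z) t - d * A * (2 * r * z - z ^+ 2) <= 0.
  move=> zr.
  have nonpos w c u : 0 <= w <= r -> x0 - r <= c <= x0 + r -> t - 1 <= u <= t ->
      2 <= A * (2 * r * w - w ^+ 2) + B * (c - x0) ^+ 2 + B * (t - u) ->
      E (c + w) u - E (c - w) u - (d * A * (2 * r * w - w ^+ 2) +
        d * B * (c - x0) ^+ 2 + d * B * (t - u)) <= 0.
    move=> /andP[w0 wr] /andP[c1 c2] ut ge2; rewrite subr_le0.
    apply: (le_trans (EE _ _ _ _ _ ut)); [lra|lra|].
    rewrite mulrC -![d * A * _]mulrA -![d * B * _]mulrA -!mulrDr.
    by rewrite ler_pM2l.
  have := @doubling_max_principle R r x0 (t - 1) t E Ex Exx
    (fun x u => s * Exx x u + alpha * (x - beta) * Ex x u) (d * A) (d * B) r0 rx0.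
  rewrite subr_gt0 gerBl => /(_ t1 ler01 (os_cont _ _ _ _ _ _ _ sE)
    (os_dx _ _ _ _ _ _ _ sE) (os_dxx _ _ _ _ _ _ _ sE) (os_dt _ _ _ _ _ _ _ sE)) H.
  have := H _ _ _ _ _ _ z x0 t zr; rewrite /= !subrr expr0n/= !mulr0 !addr0.
  apply.
  - move=> w c wr cr; apply: nonpos => //; first by rewrite lexx gerBl ler01.
    have -> : t - (t - 1) = 1 by ring.
    rewrite mulr1 ler_wpDl// addr_ge0// mulr_ge0 ?(ltW A0) ?(ltW B0)// ?sqr_ge0//.
    exact: psi0.
  - move=> c u cr ut; rewrite addr0 subr0 subrr sub0r oppr_le0.
    rewrite subrr mulr0 add0r addr_ge0// mulr_ge0 ?sqr_ge0 ?mulr_ge0 ?(ltW d0) ?(ltW B0)//.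
    by case/andP: ut => _; rewrite subr_ge0.
  - move=> c u cr ut; apply: nonpos => //; first by rewrite (ltW r0) lexx.
    have -> : 2 * r * r - r ^+ 2 = r ^+ 2 by ring.
    rewrite -addrA ler_wpDr// addr_ge0// mulr_ge0 ?sqr_ge0 ?(ltW B0)//.
    by case/andP: ut => _; rewrite subr_ge0.
  - move=> w u wr ut; apply: nonpos => //; first by rewrite lexx; lra.
    have -> : (x0 - r - x0) ^+ 2 = r ^+ 2 by ring.
    rewrite addrAC ler_wpDl// addr_ge0// mulr_ge0 ?psi0 ?(ltW A0) ?(ltW B0)//.
    by case/andP: ut => _; rewrite subr_ge0.
  - move=> w u wr ut; apply: nonpos => //; first by rewrite lexx andbT; lra.
    have -> : (x0 + r - x0) ^+ 2 = r ^+ 2 by ring.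
    rewrite addrAC ler_wpDl// addr_ge0// mulr_ge0 ?psi0 ?(ltW A0) ?(ltW B0)//.
    by case/andP: ut => _; rewrite subr_ge0.
  - move=> w c u /andP[w0 wr] /andP[c1 c2] _ Exp Exm Exxm.
    (* The drift terms are regrouped by the sum and the difference of the two gradients, the
       quantities fixed by the first order conditions. *)
    have -> : s * Exx (c + w) u + alpha * (c + w - beta) * Ex (c + w) u -
       (s * Exx (c - w) u + alpha * (c - w - beta) * Ex (c - w) u) + d * B =
       s * (Exx (c + w) u - Exx (c - w) u) +
       alpha * (c - beta) * (Ex (c + w) u - Ex (c - w) u) +
       alpha * w * (Ex (c + w) u + Ex (c - w) u) + d * B by ring.
    rewrite Exp Exm.
    have h1 : s * (Exx (c + w) u - Exx (c - w) u) <= s * (-2 * (d * A)) by rewrite ler_pM2l.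
    have h2 : (c - beta) * (c - x0) <= M.
      have n1 : `|c - x0| <= r by rewrite ler_norml; lra.
      have n2 : `|c - beta| <= x0 + `|beta| + r.
        apply: (le_trans (ler_normB _ _)); rewrite addrAC lerD2r.
        by rewrite ger0_norm; lra.
      apply: (le_trans (ler_norm _)); rewrite normrM.
      by rewrite ler_pM.
    have h3 : w * (r - w) <= r ^+ 2 / 2.
      have := sqr_ge0 (r - 2 * w); have : 0 <= r ^+ 2 by exact: ltW.
      by nra.
    have h4 : alpha * (w * (r - w)) <= s / 2.
      by apply: (@le_trans _ _ (alpha * (r ^+ 2 / 2))); [rewrite ler_pM2l|lra].
    have h5 : 2 * (d * A) * (alpha * (w * (r - w))) <= 2 * (d * A) * (s / 2).
      by rewrite ler_pM2l// !mulr_gt0.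
    have h6 : 2 * (d * B) * (alpha * ((c - beta) * (c - x0))) <= 2 * (d * B) * (alpha * M).
      by rewrite ler_pM2l ?mulr_gt0// ler_pM2l.
    have h7 : d * (B * (1 + 2 * alpha * M)) < d * (s * A) by rewrite ltr_pM2l.
    by move: (Exx _ _ - Exx _ _) h1 => Q h1; lra.
  - by rewrite lerBlDr lerDl ltW.
  - by rewrite lexx gerBl ler01.
have d1 := is_derive_faddl _ _ x0 0 _ (os_dx _ _ _ _ _ _ _ sE (x0 + 0) t _ t0).
have d2 := is_derive_fsubl _ _ x0 0 _ (os_dx _ _ _ _ _ _ _ sE (x0 - 0) t _ t0).
move: d1 d2; rewrite addr0 subr0 => /(_ x00) d1 /(_ x00) d2.
(* The increment minus its barrier is nonpositive for small [z >= 0] and zero at [z = 0], so its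
   derivative there is nonpositive. *)
have dF : is_derive (0 : R) 1 (fun z : R => E (x0 + z) t - E (x0 - z) t -
    d * A * (2 * r * z - z ^+ 2)) (2 * (Ex x0 t - A * r * d)).
  by derive; ring.
have := derive_le0_right_max _ _ _ _ dF.
rewrite pmulr_rle0// subr_le0; apply.
near=> z; rewrite addr0 subr0 subrr expr0n/= !mulr0 subrr mulr0 subr0.
apply: dbl; apply/andP; split.
  by apply/ltW; near: z; exact: nbhs_right_gt.
by near: z; exact: nbhs_right_le.
Unshelve. all: by end_near. Qed.

(** [E] and [- E] both decay uniformly, and the gradient bounds are linear in the size of the
    solution over the preceding unit of time. *)
Lemma outward_gradient_cvg0 E Ex Exx (x0 : R) :
  outward_solution R alpha beta s E Ex Exx ->
  (forall x t, 0 <= x -> 0 < t -> `|E x t| <= 1) ->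
  (E x 1 @[x --> +oo] --> 0) ->
  0 <= x0 -> Ex x0 t @[t --> +oo] --> 0.
Proof.
move=> sE E1 Ey x00.
have sNE := outward_solutionN _ _ _ _ _ _ _ sE.
have decay := outward_decay _ _ beta _ alpha0 s0.
have [K K0 HK] : exists2 K : R, 0 <= K &
  forall E Ex Exx, outward_solution R alpha beta s E Ex Exx ->
  forall d t : R, 0 < d -> 1 < t ->
  (forall x u, 0 <= x -> t - 1 <= u <= t -> `|E x u| <= d) ->
  Ex x0 t <= K * d.
  move: x00; rewrite le_eqVlt => /orP[/eqP<-|]; last exact: interior_gradient_bound.
  have [K K0 HK] := boundary_gradient_bound _ _ beta _ alpha0 s0.
  exists K => // F Fx Fxx sF d t d0 t1 Fd; apply: (HK _ _ _ sF) => // x u x0' ut.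
  exact: le_trans (ler_norm _) (Fd _ _ x0' ut).
apply/cvgrPdist_le => e e0.
pose d : R := e / (K + 1).
have K1 : 0 < K + 1 by rewrite ltr_wpDl.
have d0 : 0 < d by rewrite divr_gt0.
have Kd : K * d <= e.
  by rewrite /d mulrA ler_pdivrMr// mulrC ler_pM2l// lerDl.
have [T1 T11 HT1] := decay E Ex Exx sE
  (fun x t x0 t0 => le_trans (ler_norm _) (E1 x t x0 t0)) Ey d d0.
have E1N x t : 0 <= x -> 0 < t -> - E x t <= 1.
  by move=> x0' t0; apply: le_trans (E1 x t x0' t0); rewrite -normrN ler_norm.
have EyN : - E x 1 @[x --> +oo] --> 0 by rewrite -[0]oppr0; exact: cvgN.
have [T2 T21 HT2] := decay _ _ _ sNE E1N EyN d d0.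
near=> t.
have t1 : 1 < t by near: t; apply: nbhs_pinfty_gt; exact: num_real.
(* The added 1 is the time over which the gradient bound looks back. *)
have tT1 : T1 + 1 <= t by near: t; apply: nbhs_pinfty_ge; exact: num_real.
have tT2 : T2 + 1 <= t by near: t; apply: nbhs_pinfty_ge; exact: num_real.
have Ed x u : 0 <= x -> t - 1 <= u <= t -> `|E x u| <= d.
  move=> x0' /andP[ut _]; rewrite ler_norml; apply/andP; split.
    by rewrite lerNl HT2//; lra.
  by rewrite HT1//; lra.
rewrite sub0r normrN ler_norml; apply/andP; split.
  rewrite lerNl; apply: le_trans Kd; apply: (HK _ _ _ sNE) => // x u x0' ut.
  by rewrite normrN Ed.
by apply: le_trans Kd; apply: (HK _ _ _ sE).
Unshelve. all: by end_near. Qed.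

End OutwardGradient.

(** * From the forward equation to its primitive *)

Section MeanValue.
Variable R : realType.

Lemma mean_value_bound (f df : R -> R) (a b M : R) : a <= b ->
  {within `[a, b], continuous f} ->
  (forall x : R, a < x < b -> is_derive x 1 f (df x)) ->
  (forall x, a < x < b -> `|df x| <= M) ->
  `|f b - f a| <= M * (b - a).
Proof.
rewrite le_eqVlt => /orP[/eqP-> _ _ _|ab cf dfE dfM].
  by rewrite !subrr mulr0 normr0.
have dfo x : x \in `]a, b[ -> is_derive x 1 f (df x).
  by rewrite in_itv/=; exact: dfE.
have [c + ->] := MVT ab dfo cf.
rewrite in_itv/= => cab; rewrite normrM [X in _ * X]ger0_norm ?subr_ge0 ?(ltW ab)//.
by rewrite ler_pM2r ?subr_gt0// dfM.
Qed.

Lemma mean_value_linear_bound (f df : R -> R) (t u L M : R) :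
  (forall c : R, `|c - t| <= `|u - t| -> is_derive c 1 f (df c)) ->
  (forall c, `|c - t| <= `|u - t| -> `|df c - L| <= M) ->
  `|f u - f t - (u - t) * L| <= M * `|u - t|.
Proof.
move=> dfE dfM.
have aux (a b : R) : a <= b ->
    (forall c, a <= c <= b -> `|c - t| <= `|u - t|) ->
    `|f b - f a - (b - a) * L| <= M * (b - a).
  move=> ab cab.
  have d (c : R) : a <= c <= b -> is_derive c 1 (fun y => f y - y * L) (df c - L).
    by move=> /cab /dfE h; derive; ring.
  have := @mean_value_bound (fun y => f y - y * L) (fun c => df c - L) a b M ab.
  have -> : f b - b * L - (f a - a * L) = f b - f a - (b - a) * L by ring.
  apply.
  - by apply: derivable_within_continuous => c; rewrite in_itv/= => /d[].
  - by move=> c /andP[ac cb]; apply: d; rewrite !ltW.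
  - by move=> c /andP[ac cb]; apply/dfM/cab; rewrite !ltW.
have [tu|ut] := leP t u.
  rewrite (ger0_norm (_ : 0 <= u - t)) ?subr_ge0//; apply: aux => // c /andP[tc cu].
  by rewrite !ger0_norm ?subr_ge0// lerD2r.
rewrite (ltr0_norm (_ : u - t < 0)) ?subr_lt0// opprB.
have -> : f u - f t - (u - t) * L = - (f t - f u - (t - u) * L) by ring.
rewrite normrN; apply: aux; first exact: ltW.
move=> c /andP[uc ct]; have ct0 : c - t <= 0 by rewrite subr_le0.
have ut0 : u - t <= 0 by rewrite subr_le0 ltW.
by rewrite (ler0_norm ct0) (ler0_norm ut0) lerN2 lerD2r.
Qed.

(** Joint continuity controls [F] near each [(y, t)]; compactness of [[a, b]], in its near-covering
    form, makes the neighbourhood of [t] uniform in [y]. *)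
Lemma uniform_in_time (A : set (R * R)) (F : R -> R -> R) (a b t e : R) :
  {within A, continuous (fun z => F z.1 z.2)} ->
  (\forall u \near t, forall y, a <= y <= b -> A (y, u)) -> 0 < e ->
  \forall u \near t, forall y, a <= y <= b -> `|F y u - F y t| <= e.
Proof.
move=> /subspace_continuousP cF At e0.
have At0 y : a <= y <= b -> A (y, t) by apply: (nbhs_singleton At).
have cK : near_covering_within `[a, b].
  exact/near_covering_withinP/compact_near_coveringP/segment_compact.
have := cK R (nbhs t) (fun u y => `|F y u - F y t| <= e) _ _.
suff H : forall y, `[a, b]%classic y -> \forall y' \near y & u \near t,
    `[a, b]%classic y' -> `|F y' u - F y' t| <= e.
  move=> /(_ _ H); apply: filterS => u Hu y yab; apply: Hu.
  by rewrite /= in_itv.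
move=> y; rewrite /= in_itv/= => yab.
have e2 : 0 < e / 2 by rewrite divr_gt0.
have /cvgrPdist_le /(_ _ e2) := cF (y, t) (At0 y yab).
rewrite near_withinE => near1.
have {near1}[[U V] /= [Uy Vt] UV] : filter_prod (nbhs y) (nbhs t)
    (fun z => A z -> `|F y t - F z.1 z.2| <= e / 2) by exact: near1.
exists (U, V `&` [set u | forall y, a <= y <= b -> A (y, u)]) => /=.
  by split => //; exact: filterI.
move=> [y' u]/= [Uy' [Vu Au]]; rewrite in_itv/= => y'ab.
have h1 := UV (y', u) (conj Uy' Vu) (Au y' y'ab).
have h2 := UV (y', t) (conj Uy' (nbhs_singleton Vt)) (At0 y' y'ab).
have -> : F y' u - F y' t = (F y t - F y' t) - (F y t - F y' u) by ring.
by rewrite (le_trans (ler_normB _ _))// [leRHS]splitr lerD.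
Qed.

End MeanValue.

Section Forward.
Variable R : realType.
Variables (alpha beta s : R).

(** The equation is kept in divergence form, [qt] being the space derivative of the flux; [qx] is
    continuous up to [x = 0], so that the flux has a value at the origin. *)
Record forward_solution (q qx qt : R -> R -> R) : Prop := {
  fs_cont : {within [set z | 0 <= z.1 /\ 0 < z.2],
    continuous (fun z : R * R => q z.1 z.2)} ;
  fs_contx : {within [set z | 0 <= z.1 /\ 0 < z.2],
    continuous (fun z : R * R => qx z.1 z.2)} ;
  fs_contt : {within [set z | 0 < z.1 /\ 0 < z.2],
    continuous (fun z : R * R => qt z.1 z.2)} ;
  fs_dx : forall x t : R, 0 < x -> 0 < t -> is_derive x 1 (q^~ t) (qx x t) ;
  fs_dt : forall x t : R, 0 < x -> 0 < t -> is_derive t 1 (q x) (qt x t) ;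
  fs_dflux : forall x t : R, 0 < x -> 0 < t ->
    is_derive x 1 (fun y => s * qx y t + alpha * (y - beta) * q y t) (qt x t)
}.

(** Integrating the divergence form from the origin, where the flux vanishes, gives [G_t = P]. As
    [qt] is controlled for [x > 0] only, the time derivative is first computed for [G x - G y] with
    [y > 0], and then [y] tends to 0. *)
Lemma primitive_outward_solution (q qx qt G : R -> R -> R) :
  forward_solution q qx qt ->
  (forall t, 0 < t -> s * qx 0 t + alpha * (0 - beta) * q 0 t = 0) ->
  (forall t, 0 < t -> G 0 t = 0) ->
  (forall t, 0 < t -> {within [set x | 0 <= x], continuous (G^~ t)}) ->
  (forall x t : R, 0 < x -> 0 < t -> is_derive x 1 (G^~ t) (q x t)) ->
  outward_solution R alpha beta s G q qx.
Proof.
case=> cq cqx cqt dqx dqt dP P0 G0 cG dG.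
pose P x t := s * qx x t + alpha * (x - beta) * q x t.
have cP : {within [set z | 0 <= z.1 /\ 0 < z.2],
    continuous (fun z : R * R => P z.1 z.2)}.
  move=> z; apply: cvgD; first by apply: cvgM; [exact: cvg_cst|exact: cqx].
  apply: cvgM; last exact: cq.
  move: z; apply: continuous_subspaceT => z.
  apply: cvgM; first exact: cvg_cst.
  by apply: cvgB; [exact: cvg_fst|exact: cvg_cst].
have cG0 (t x : R) : 0 < t -> 0 <= x -> {within `[0, x], continuous (G^~ t)}.
  move=> t0 x0; apply: continuous_subspaceW (cG t t0).
  by move=> y /=; rewrite in_itv/= => /andP[].
split => //.
- apply/subspace_continuousP => -[x t]/= [x0 t0].
  apply/cvgrPdist_le => e e0.
  (* [e'] compensates for the length, at most [x + 1], of the interval on which the mean value bound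
     is used. *)
  pose e' : R := e / 2 / (x + 1).
  have x1 : 0 < x + 1 by rewrite ltr_wpDl.
  have e'0 : 0 < e' by rewrite !divr_gt0.
  have Gu : \forall u \near t, forall y, 0 <= y <= x + 1 -> `|G y u - G y t| <= e / 2.
    have near1 : \forall u \near t, forall y, 0 <= y <= x + 1 -> `|q y u - q y t| <= e'.
      apply: uniform_in_time cq _ e'0.
      by apply: filterS (near_lt _ _ _ t0) => u u0 y /andP[].
    apply: filterS2 near1 (near_lt _ _ _ t0) => u qu u0 y /andP[y0 yx].
    have := @mean_value_bound R (fun y => G y u - G y t) (fun y => q y u - q y t) 0 y e' y0.
    rewrite !G0// !subr0 => /(_ _ _ _)/le_trans; apply.
    + by move=> z; apply: cvgB; exact: cG0.
    + move=> z /andP[z0 _]; have d1 := dG z u z0 u0; have d2 := dG z t z0 t0.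
      by derive.
    + by move=> z /andP[z0 zy]; apply: qu; rewrite (ltW z0) (le_trans (ltW zy)).
    + by rewrite /e' mulrAC ler_pdivrMr// ler_pM2l// divr_gt0.
  have Gx : \forall y \near x, 0 <= y -> `|G x t - G y t| <= e / 2.
    have /subspace_continuousP /(_ x x0) := cG t t0.
    by move=> /cvgrPdist_le /(_ (e / 2)); rewrite near_withinE; apply; rewrite divr_gt0.
  have xx1 : \forall y \near x, y < x + 1 by apply: lt_nbhsl; rewrite ltrDl.
  rewrite near_withinE.
  have : \forall y \near x & u \near t, 0 <= y /\ 0 < u -> `|G x t - G y u| <= e.
    exists ([set y | 0 <= y -> `|G x t - G y t| <= e / 2] `&` [set y | y < x + 1],
      [set u | forall y, 0 <= y <= x + 1 -> `|G y u - G y t| <= e / 2]) => /=.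
      by split => //; exact: filterI.
    move=> [y u]/= [[Hy y1] Hu] [y0 u0].
    have -> : G x t - G y u = (G x t - G y t) - (G y u - G y t) by ring.
    rewrite (le_trans (ler_normB _ _))// [leRHS]splitr lerD ?Hy ?Hu//.
    by rewrite y0 ltW.
  by [].
- move=> x t x0 t0.
  (* The function [G z (u + h) - G z u - h * P z u] of [z] has the derivative
     [q z (u + h) - q z u - h * qt z u], which is small compared with [h], uniformly on [[y, x]]. *)
  have dH (y u : R) : 0 < y -> y < x -> 0 < u ->
      is_derive u 1 (fun u => G x u - G y u) (P x u - P y u).
    move=> y0 yx u0; apply: quotient_is_derive; apply/cvgrPdist_le => e e0.
    pose e' : R := e / (x - y).
    have xy0 : 0 < x - y by rewrite subr_gt0.
    have e'0 : 0 < e' by rewrite divr_gt0.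
    have : \forall v \near u, forall z, y <= z <= x -> `|qt z v - qt z u| <= e'.
      apply: uniform_in_time cqt _ e'0.
      by apply: filterS (near_lt _ _ _ u0) => v v0 z /andP[yz _]; split => //=; exact: lt_le_trans yz.
    move=> /nbhs_ballP[r /= r0 Hr].
    near=> h.
    have h0 : h != 0 by near: h; exact: nbhs_dnbhs_neq.
    have hr : `|h| < Num.min r u.
      near: h; apply: dnbhs0_lt; by rewrite lt_min r0.
    move: hr; rewrite lt_min => /andP[hr hu].
    have := @mean_value_bound R (fun z => G z (u + h) - G z u - h * P z u)
      (fun z => q z (u + h) - q z u - h * qt z u) y x (e' * `|h|) (ltW yx).
    have uh0 : 0 < u + h by move: hu; rewrite ltr_norml => /andP[+ _]; lra.
    move=> /(_ _ _ _) H.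
    have {}H : `|G x (u + h) - G x u - h * P x u - (G y (u + h) - G y u - h * P y u)| <= e' * `|h| * (x - y).
      apply: H.
      + have sub : `[y, x] `<=` [set z : R | 0 <= z].
          by move=> z /=; rewrite in_itv/= => /andP[yz _]; apply/ltW/(lt_le_trans y0).
        move=> z; apply: cvgB; first apply: cvgB.
        - exact: (continuous_subspaceW sub (cG _ uh0)).
        - exact: (continuous_subspaceW sub (cG _ u0)).
        - apply: cvgM; first exact: cvg_cst.
          exact: (continuous_subspaceW sub (within_continuous_section _ _ _ u0 cP)).
      + move=> z /andP[yz zx]; have z0 : 0 < z by exact: lt_trans yz.
        have d1 := dG z u z0 u0; have d2 := dG z _ z0 uh0; have d3 := dP z u z0 u0.
        by rewrite /P; derive; ring.
      + move=> z /andP[yz zx]; have z0 : 0 < z by exact: lt_trans yz.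
        have := @mean_value_linear_bound R (q z) (qt z) u (u + h) (qt z u) e'.
        rewrite [u + h - u]addrC addKr; apply => c cu.
          apply: dqt => //; move: (le_lt_trans cu hu); rewrite ltr_norml => /andP[+ _]; lra.
        apply: Hr; last by rewrite !ltW.
        by rewrite /ball/= distrC (le_lt_trans cu).
    have -> : P x u - P y u - h^-1 * (G x (u + h) - G y (u + h) - (G x u - G y u)) =
      - (h^-1 * (G x (u + h) - G x u - h * P x u - (G y (u + h) - G y u - h * P y u))).
      by field.
    rewrite normrN normrM normfV ler_pdivrMl ?normr_gt0//.
    apply: (le_trans H); rewrite /e' mulrAC divfK ?gt_eqF// mulrC.
    exact: lexx.
  apply: quotient_is_derive; apply/cvgrPdist_le => e e0.
  have e2 : 0 < e / 2 by rewrite divr_gt0.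
  (* The flux is zero at [(0, t)], hence small around this point. *)
  have [d d0 Hd] : exists2 d : R, 0 < d & forall y u, 0 <= y -> y < d -> 0 < u ->
      `|u - t| < d -> `|P y u| <= e / 2.
    have /subspace_continuousP /(_ (0, t) (conj (lexx _) t0)) := cP.
    move=> /cvgrPdist_le /(_ _ e2); rewrite near_withinE => /nbhs_ballP[d /= d0 Hd].
    exists d => // y u y0 yd u0 ud.
    have -> : P y u = - (P 0 t - P y u) by rewrite [P 0 t](P0 t t0); ring.
    rewrite normrN; apply: (Hd (y, u)) => //; split; rewrite /ball/=.
      by rewrite sub0r normrN ger0_norm.
    by rewrite distrC.
  have [d' d'0 Hd'] : exists2 d' : R, 0 < d' & forall u, 0 < u ->
      `|u - t| < d' -> `|P x u - P x t| <= e / 2.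
    have /subspace_continuousP /(_ (x, t) (conj (ltW x0) t0)) := cP.
    move=> /cvgrPdist_le /(_ _ e2); rewrite near_withinE => /nbhs_ballP[d' /= d'0 Hd'].
    exists d' => // u u0 ud.
    rewrite distrC; apply: (Hd' (x, u)) => /=; last by split => //; exact: ltW.
    by split; [exact: ballxx|rewrite /ball/= distrC].
  near=> h.
  have h0 : h != 0 by near: h; exact: nbhs_dnbhs_neq.
  have : `|h| < Num.min t (Num.min d d').
    by near: h; apply: dnbhs0_lt; rewrite !lt_min t0 d0.
  rewrite !lt_min => /and3P[ht hd hd'].
  have th0 : 0 < t + h by move: ht; rewrite ltr_norml => /andP[+ _]; lra.
  (* The bound is the same for all small [y], so that [y] can tend to 0 with [h] fixed. *)
  have bound y : 0 < y -> y < x -> y < d ->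
      `|G x (t + h) - G y (t + h) - (G x t - G y t) - h * P x t| <= e * `|h|.
    move=> y0 yx yd.
    have := @mean_value_linear_bound R (fun u => G x u - G y u) (fun u => P x u - P y u) t (t + h) (P x t) e.
    rewrite [t + h - t]addrC addKr; apply => c ct.
      apply: dH => //; move: (le_lt_trans ct ht); rewrite ltr_norml => /andP[+ _]; lra.
    have c0 : 0 < c by move: (le_lt_trans ct ht); rewrite ltr_norml => /andP[+ _]; lra.
    have -> : P x c - P y c - P x t = (P x c - P x t) - P y c by ring.
    rewrite (le_trans (ler_normB _ _))// [leRHS]splitr lerD//.
      by apply: Hd' => //; exact: le_lt_trans hd'.
    by apply: Hd => //; [exact: ltW|exact: le_lt_trans hd].
  have lim : G x (t + h) - G y (t + h) - (G x t - G y t) - h * P x t @[y --> 0^'+] -->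
      G x (t + h) - 0 - (G x t - 0) - h * P x t.
    apply: cvgB; last exact: cvg_cst.
    apply: cvgB; (apply: cvgB; first exact: cvg_cst).
      by have := within_continuous_cvg_right _ _ (cG _ th0); rewrite G0.
    by have := within_continuous_cvg_right _ _ (cG _ t0); rewrite G0.
  have : `|G x (t + h) - 0 - (G x t - 0) - h * P x t| <= e * `|h|.
    apply: (cvgr_to_le (cvg_norm lim)); near=> y; apply: bound.
    + by near: y; exact: nbhs_right_gt.
    + by near: y; exact: nbhs_right_lt.
    + by near: y; exact: nbhs_right_lt.
  rewrite !subr0 => H.
  have -> : P x t - h^-1 * (G x (t + h) - G x t) =
     - (h^-1 * (G x (t + h) - G x t - h * P x t)) by field.
  by rewrite normrN normrM normfV ler_pdivrMl ?normr_gt0// [leRHS]mulrC.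
Unshelve. all: by end_near. Qed.

End Forward.

(** * Distribution function of a density on the half-line *)

Section Primitive.
Variable R : realType.
Notation mu := (@lebesgue_measure R).

Lemma density_primitive (phi : R -> R) :
  {within [set x | 0 <= x], continuous phi} -> (forall x, 0 <= x -> 0 <= phi x) ->
  (\int[mu]_(x in `[0%R, +oo[) (phi x)%:E = 1)%E ->
  exists G : R -> R, [/\ G 0 = 0, {within [set x | 0 <= x], continuous G},
    forall x : R, 0 < x -> is_derive x 1 G (phi x),
    forall x, 0 <= x -> 0 <= G x <= 1 & (G x @[x --> +oo] --> (1 : R))].
Proof.
move=> cphi phi0 phi1.
(* [phi] is only controlled on the half-line: extend it by a constant. *)
pose f (x : R) : R := phi (Num.max 0 x).
have fE x : 0 <= x -> f x = phi x by move=> x0; rewrite /f max_r.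
have f0 x : 0 <= f x by apply: phi0; rewrite le_max lexx.
have cf : continuous f.
  apply/continuous_subspace_setT.
  apply: (@within_continuous_comp_sub R R R setT [set x | 0 <= x] phi (Num.max 0)) cphi => //.
    by move=> x; apply: continuous_max; [exact: cvg_cst|exact: cvg_id].
  by move=> x _ /=; rewrite le_max lexx.
have mf : measurable_fun setT f by exact: (continuous_measurable_fun cf).
have f1 : (\int[mu]_(x in `[0%R, +oo[) (f x)%:E = 1)%E.
  rewrite -phi1; apply: eq_integral => x; rewrite inE/= in_itv/= andbT => x0.
  by rewrite fE.
pose Ge x := (\int[mu]_(y in `[0%R, x]) (f y)%:E)%E.
have mfE (A : set R) : measurable A -> measurable_fun A (fun y => (f y)%:E).
  by move=> mA; apply: measurable_funTS; exact/measurable_EFinP.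
have Ge0 x : (0 <= Ge x)%E by apply: integral_ge0 => y _; rewrite lee_fin.
have Ge1 x : (Ge x <= 1)%E.
  rewrite -f1; apply: ge0_subset_integral => //.
  - exact: mfE.
  - by move=> y _; rewrite lee_fin.
  - by move=> y /=; rewrite !in_itv/= andbT => /andP[].
have Gefin x : Ge x \is a fin_num.
  by rewrite ge0_fin_numE// (le_lt_trans (Ge1 x))// ltry.
have Gele x y : x <= y -> (Ge x <= Ge y)%E.
  move=> xy; apply: ge0_subset_integral => //.
  - exact: mfE.
  - by move=> z _; rewrite lee_fin.
  - by move=> z /=; rewrite !in_itv/= => /andP[-> /le_trans]; apply.
have intf (x : R) : mu.-integrable `[0, x] (EFin \o f).
  by apply: continuous_compact_integrable; [exact: segment_compact|exact: continuous_subspaceT].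
exists (fun x => fine (Ge x)); split.
- by rewrite /Ge set_itv1 integral_set1.
- apply/subspace_continuousP => x /= x0.
  have x01 : 0 <= x + 1 by rewrite addr_ge0.
  have /subspace_continuousP /(_ x) := parameterized_integral_continuous x01 (intf (x + 1)).
  rewrite /= in_itv/= x0 lerDl ler01 => /(_ isT) cG V /cG near1.
  have {}near1 : \forall y \near x, `[0, x + 1]%classic y -> V (fine (Ge y)) by exact: near1.
  suff : \forall y \near x, 0 <= y -> V (fine (Ge y)) by [].
  have near2 : \forall y \near x, y < x + 1 by apply: lt_nbhsl; rewrite ltrDl.
  apply: filterS2 near1 near2 => y + yx y0; apply.
  by rewrite /= in_itv/= y0 ltW.
- move=> x x0.
  have [] := @continuous_FTC1_closed R f 0 x (x + 1) _ (intf _) x0 (cf x).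
    by rewrite ltrDl.
  by move=> dG; rewrite derive1E fE 1?ltW// => GE; exact: DeriveDef.
- move=> x _; rewrite fine_ge0//=.
  by rewrite -[leRHS]/(fine 1%E) fine_le.
(* Monotone convergence gives the limit along the integers; monotonicity of [Ge] extends it to real
   [x]. *)
- have cvn : Ge n%:R @[n --> \oo] --> 1%E.
    by rewrite -f1; apply: ge0_cvgn_integral => //; exact: mf.
  have {}cvn : fine (Ge n%:R) @[n --> \oo] --> (1 : R) by exact: (fine_cvg cvn).
  apply/cvgrPdist_le => e e0.
  move: cvn => /cvgrPdist_le /(_ _ e0) [n _ /(_ n (leqnn n)) /= Hn].
  near=> x.
  have nx : n%:R <= x by near: x; apply: nbhs_pinfty_ge; exact: num_real.
  have G1 y : fine (Ge y) <= 1 by rewrite -[leRHS]/(fine 1%E) fine_le.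
  move: Hn; rewrite !ger0_norm ?subr_ge0//; apply: le_trans.
  by rewrite lerD2l lerN2 fine_le// Gele.
Unshelve. all: by end_near. Qed.

End Primitive.

(** * Second derivatives and a Lyapunov function *)

Section Dirichlet.
Variable R : realType.
Variables (alpha beta s : R).
Hypotheses (alpha0 : 0 < alpha) (s0 : 0 < s).

Lemma forward_solutionN q qx qt : forward_solution R alpha beta s q qx qt ->
  forward_solution R alpha beta s (fun x t => - q x t) (fun x t => - qx x t)
    (fun x t => - qt x t).
Proof.
case=> cq cqx cqt dqx dqt dP; split => [| | |x t x0 t0|x t x0 t0|x t x0 t0].
- by move=> z; apply: cvgN; exact: cq.
- by move=> z; apply: cvgN; exact: cqx.
- by move=> z; apply: cvgN; exact: cqt.
- exact/is_derive_fN/dqx.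
- exact/is_derive_fN/dqt.
- have d1 := is_derive_fN _ _ _ _ (dP x t x0 t0).
  by under eq_fun do rewrite !mulrN -opprD.
Qed.

Lemma forward_solution_dxx q qx qt : forward_solution R alpha beta s q qx qt ->
  forall x t : R, 0 < x -> 0 < t -> is_derive x 1 (qx^~ t)
    ((qt x t - alpha * q x t - alpha * (x - beta) * qx x t) / s).
Proof.
case=> _ _ _ dqx _ dP x t x0 t0.
have d1 := dP x t x0 t0; have d2 := dqx x t x0 t0.
have -> : qx^~ t = (fun y => s^-1 * (s * qx y t + alpha * (y - beta) * q y t
    - alpha * (y - beta) * q y t)).
  by apply/funext => y; rewrite addrK mulKf// gt_eqF.
have d3 := is_derive_fM _ _ _ _ _ _ (is_derive_fM _ _ _ _ _ _ (is_derive_fcst _ alpha x)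
  (is_derive_fD _ _ _ _ _ _ (is_derive_fid _ x) (is_derive_fcst _ (- beta) x))) d2.
have d4 := is_derive_fM _ _ _ _ _ _ (is_derive_fcst _ s^-1 x)
  (is_derive_fD _ _ _ _ _ _ d1 (is_derive_fN _ _ _ _ d3)).
notypeclasses refine (is_derive_eq d4 _); field; by rewrite gt_eqF.
Qed.

(** The last inequality concerns the generator of the process. The linear part of [S] yields it for
    [x >= b]; closer to the origin, a concave exponential term makes up for the drift. *)
Lemma lyapunov_function : exists (S S1 S2 : R -> R), [/\
  (forall x : R, is_derive x 1 S (S1 x)), (forall x : R, is_derive x 1 S1 (S2 x)),
  exists2 c : R, 0 < c & forall x, 0 <= x -> c + x <= S x,
  forall x y, x <= y -> S x <= S y &
  forall x, 0 <= x -> s * S2 x - alpha * (x - beta) * S1 x <= - alpha].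
Proof.
(* [b] leaves a margin of 1 above [beta]; [k] gives [s * k = alpha * b], and [c] gives
   [c * k * expR (- (k * x)) >= b] on [[0, b]]. *)
pose b : R := `|beta| + 1.
have b0 : 0 < b by rewrite ltr_wpDl.
pose k : R := alpha * b / s.
have k0 : 0 < k by rewrite divr_gt0// mulr_gt0.
pose c : R := b * expR (k * b) / k.
have c0 : 0 < c by rewrite divr_gt0// mulr_gt0// expR_gt0.
exists (fun x => x + c * (2 - expR (- (k * x)))).
exists (fun x => 1 + c * k * expR (- (k * x))).
exists (fun x => - (c * k ^+ 2 * expR (- (k * x)))).
split.
- by move=> x; derive; ring.
- by move=> x; derive; ring.
- exists c => // x x0; rewrite addrC lerD2l ler_peMr ?(ltW c0)//.
  suff : expR (- (k * x)) <= 1 by lra.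
  by rewrite -[leRHS]expR0 ler_expR oppr_le0 mulr_ge0// ltW.
- move=> x y xy; apply: lerD => //; rewrite ler_pM2l// lerD2l lerN2 ler_expR lerN2.
  by rewrite ler_pM2l.
- move=> x x0; set e := expR _.
  have e0 : 0 < e by exact: expR_gt0.
  have -> : s * - (c * k ^+ 2 * e) - alpha * (x - beta) * (1 + c * k * e) =
    - (alpha * (x - beta)) - c * k * e * (s * k + alpha * (x - beta)) by ring.
  have -> : s * k = alpha * b by rewrite /k mulrC divfK// gt_eqF.
  have bb : - (b - 1) <= - beta by rewrite lerN2 /b addrK ler_norm.
  have h1 : alpha * (1 + x) <= alpha * b + alpha * (x - beta).
    by rewrite -mulrDr ler_pM2l//; lra.
  have [bx|xb] := leP b x.
    have h2 : alpha * 1 <= alpha * (x - beta) by rewrite ler_pM2l//; lra.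
    have h3 : 0 <= c * k * e * (alpha * b + alpha * (x - beta)).
      apply: mulr_ge0; first by rewrite mulr_ge0 ?(ltW e0)// mulr_ge0 ?(ltW c0) ?(ltW k0).
      by apply: le_trans h1; rewrite mulr_ge0 ?addr_ge0// ltW.
    by rewrite mulr1 in h2; lra.
  have h2 : b <= c * k * e.
    rewrite /c divfK ?gt_eqF// -mulrA -expRD ler_peMr ?(ltW b0)//.
    by rewrite -[leLHS]expR0 ler_expR subr_ge0 ler_pM2l// ltW.
  have h3 : b * alpha <= c * k * e * (alpha * b + alpha * (x - beta)).
    apply: ler_pM => //; [exact: ltW|exact: ltW|].
    by apply: le_trans h1; rewrite ler_peMr ?(ltW alpha0)// lerDl.
  have h4 : alpha * (beta - x) <= alpha * (b - 1) by rewrite ler_pM2l//; lra.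
  by lra.
Qed.

End Dirichlet.

(** * The forward equation with an absorbing origin *)

Section DirichletDecay.
Variable R : realType.
Variables (alpha beta s : R).
Hypotheses (alpha0 : 0 < alpha) (s0 : 0 < s).
Local Notation w0 := (ou_weight alpha beta s).

(** The reciprocal of [ou_weight], with logarithmic derivative [k]: multiplication by [m] turns
    forward solutions into backward ones. *)
Let m (x : R) : R := expR (alpha / (2 * s) * (x - beta) ^+ 2).
Let k (x : R) : R := alpha / s * (x - beta).

Let dm (x : R) : is_derive x 1 m (k x * m x).
Proof. by rewrite /m; derive; rewrite /k; field; rewrite gt_eqF. Qed.

Let cm : continuous m.
Proof. by move=> x; apply/differentiable_continuous/derivable1_diffP; have [] := dm x. Qed.

(** Both terms of the bound are supersolutions of the backward equation satisfied by [m * h]. The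
    first equals [kappa] at [X], the second dominates at time [T]; its rate [alpha / S X] is allowed
    because [S x <= S X]. *)
Lemma dirichlet_upper_bound h hx ht : forward_solution R alpha beta s h hx ht ->
  (forall t, 0 < t -> h 0 t = 0) ->
  forall S S1 S2 : R -> R,
  (forall x : R, is_derive x 1 S (S1 x)) -> (forall x : R, is_derive x 1 S1 (S2 x)) ->
  (forall x, 0 <= x -> 0 < S x) -> (forall x y, x <= y -> S x <= S y) ->
  (forall x, 0 <= x -> s * S2 x - alpha * (x - beta) * S1 x <= - alpha) ->
  forall X T kappa N : R, 0 < X -> 0 < T -> 0 < kappa -> 0 <= N ->
  (forall t, T <= t -> m X * h X t <= kappa) ->
  (forall x, 0 <= x <= X -> m x * h x T <= N * S x) ->
  forall x t, 0 <= x <= X -> T <= t ->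
    m x * h x t <= kappa / S X * S x + N * expR (- (alpha / S X * (t - T))) * S x.
Proof.
move=> sh h0 S S1 S2 dS dS1 S0 Smono LS X T kappa N X0 T0 kappa0 N0 hX hT x1 t1 x1X t1T.
have SX : 0 < S X by rewrite S0// ltW.
pose v x t := m x * h x t
  - (kappa / S X * S x + N * expR (- (alpha / S X * (t - T))) * S x).
have cS : continuous S.
  by move=> x; apply/differentiable_continuous/derivable1_diffP; have [] := dS x.
rewrite -subr_le0 -/(v x1 t1).
have barrier_ge0 x t : 0 <= x -> 0 <= kappa / S X * S x /\
    0 <= N * expR (- (alpha / S X * (t - T))) * S x.
  move=> x0; have Sx := S0 x x0; split.
    by rewrite mulr_ge0 ?(ltW Sx)// divr_ge0// ltW.
  by rewrite mulr_ge0 ?(ltW Sx)// mulr_ge0// expR_ge0.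
apply: (@rectangle_max_principle R 0 X T t1 v _ t1T) => //.
- exact: ltW.
- have c1 : continuous (fun p : R * R => p.1) by move=> p; exact: cvg_fst.
  have c2 : continuous (fun p : R * R => p.2) by move=> p; exact: cvg_snd.
  have ce (f : R * R -> R) : continuous f -> continuous (fun p => expR (f p)).
    by move=> cf p; apply: continuous_comp; [exact: cf|exact: continuous_expR].
  have cSz : continuous (fun p : R * R => S p.1).
    by move=> p; apply: continuous_comp; [exact: c1|exact: cS].
  have cmz : continuous (fun p : R * R => m p.1).
    by move=> p; apply: continuous_comp; [exact: c1|exact: cm].
  move=> z; apply: cvgB; first apply: cvgM.
  + by move: z; apply: continuous_subspaceT.
  + move: z; apply: continuous_subspaceW (fs_cont _ _ _ _ _ _ _ sh).
    move=> [x t]/=; rewrite !in_itv/= => -[/andP[x0 _] /andP[Tt _]].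
    by split => //; exact: lt_le_trans Tt.
  + move: z; apply: continuous_subspaceT => z.
    apply: cvgD; first by apply: cvgM; [exact: cvg_cst|exact: cSz].
    apply: cvgM; last exact: cSz.
    apply: cvgM; first exact: cvg_cst.
    apply: (ce (fun p => - (alpha / S X * (p.2 - T)))) => p.
    apply: cvgN; apply: cvgM; first exact: cvg_cst.
    by apply: cvgB; [exact: c2|exact: cvg_cst].
- move=> x /[dup] xX /andP[x0 _]; rewrite /v subr_le0 (le_trans (hT x xX))//.
  rewrite subrr mulr0 oppr0 expR0 mulr1 lerDr.
  by have [] := barrier_ge0 x T x0.
- move=> t /andP[tT _]; rewrite /v h0; last exact: lt_le_trans tT.
  rewrite mulr0 sub0r oppr_le0.
  by have [b1 b2] := barrier_ge0 0 t (lexx _); exact: addr_ge0.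
- move=> t /andP[tT _]; rewrite /v subr_le0 (le_trans (hX t tT))//.
  by rewrite divfK ?gt_eqF// lerDl; have [] := barrier_ge0 X t (ltW X0).
- move=> x t /andP[x0 xX] /andP[tT _] _.
  have t0 : 0 < t by exact: lt_trans tT.
  have dx (y : R) : 0 < y -> is_derive y 1 (v^~ t) (m y * (hx y t + k y * h y t)
      - (kappa / S X + N * expR (- (alpha / S X * (t - T)))) * S1 y).
    move=> y0; have d1 := fs_dx _ _ _ _ _ _ _ sh y t y0 t0.
    have d2 := dm y; have d3 := dS y.
    by rewrite /v; derive; ring.
  pose hxx := (ht x t - alpha * h x t - alpha * (x - beta) * hx x t) / s.
  exists (fun y => m y * (hx y t + k y * h y t)
      - (kappa / S X + N * expR (- (alpha / S X * (t - T)))) * S1 y).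
  exists (m x * ht x t + alpha / S X * N * expR (- (alpha / S X * (t - T))) * S x).
  exists (m x * (hxx + k x * hx x t + alpha / s * h x t)
     + k x * m x * (hx x t + k x * h x t)
     - (kappa / S X + N * expR (- (alpha / S X * (t - T)))) * S2 x).
  split.
  + have d1 := fs_dt _ _ _ _ _ _ _ sh x t x0 t0.
    by rewrite /v; derive; ring.
  + by apply: filterS (near_lt _ _ _ x0) => y; exact: dx.
  + have d1 := fs_dx _ _ _ _ _ _ _ sh x t x0 t0; have d2 := dm x; have d3 := dS1 x.
    have d4 := forward_solution_dxx _ _ _ _ s0 _ _ _ sh x t x0 t0.
    have d5 : is_derive x 1 k (alpha / s) by rewrite /k; derive; ring.
    by derive; rewrite -/hxx; ring.
  + set e := expR _; have e0 : 0 <= e by exact: expR_ge0.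
    set th := kappa / S X + N * e.
    move=> /eqP; rewrite subr_eq0 => /eqP mh.
    rewrite subr_le0 => q0.
    (* The backward equation for [m * h], with drift [- alpha * (x - beta)]. *)
    have -> : m x * ht x t = s * (m x * (hxx + k x * hx x t + alpha / s * h x t)
      + k x * m x * (hx x t + k x * h x t))
      - alpha * (x - beta) * (m x * (hx x t + k x * h x t)).
      by rewrite /hxx /k; field; rewrite gt_eqF.
    have h1 : s * (m x * (hxx + k x * hx x t + alpha / s * h x t)
      + k x * m x * (hx x t + k x * h x t)) <= s * (th * S2 x) by rewrite ler_pM2l.
    have th0 : 0 < th by rewrite ltr_wpDr ?mulr_ge0 ?divr_gt0.
    have h2 : th * (s * S2 x - alpha * (x - beta) * S1 x) <= th * - alpha.
      by rewrite ler_pM2l// LS// ltW.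
    have h3 : alpha / S X * N * e * S x <= alpha * N * e.
      have -> : alpha / S X * N * e * S x = alpha * N * e * (S x / S X) by ring.
      rewrite ler_piMr//; first by rewrite mulr_ge0// mulr_ge0// ltW.
      by rewrite ler_pdivrMr// mul1r Smono// ltW.
    have h4 : 0 < alpha * (kappa / S X) by rewrite mulr_gt0// divr_gt0.
    rewrite mh; apply: (@le_lt_trans _ _ (s * (th * S2 x) - alpha * (x - beta) * (th * S1 x) + alpha * N * e)).
      by apply: lerD => //; rewrite lerD2r.
    apply: (@le_lt_trans _ _ (th * - alpha + alpha * N * e)).
      rewrite lerD2r; apply: le_trans h2; rewrite le_eqVlt; apply/orP; left; apply/eqP; ring.
    by rewrite /th; lra.
- by rewrite t1T lexx.
Qed.

(** The same [kappa] serves for every [X]: for [X] far away the contribution [kappa * S x / S X] of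
    that end is negligible, and the contribution of time [T] decays. *)
Lemma dirichlet_limsup h hx ht kappa (x : R) :
  forward_solution R alpha beta s h hx ht ->
  (forall t, 0 < t -> h 0 t = 0) -> 0 < kappa ->
  (forall X, 0 < X -> \forall t \near +oo, h X t <= kappa * w0 X) -> 0 <= x ->
  forall e, 0 < e -> \forall t \near +oo, h x t <= e.
Proof.
move=> sh h0 kappa0 hX x0 e e0.
have [S [S1 [S2 [dS dS1 [c c0 cS] Smono LS]]]] := lyapunov_function _ _ beta _ alpha0 s0.
have S0 y : 0 <= y -> 0 < S y.
  by move=> y0; apply: (lt_le_trans _ (cS y y0)); rewrite ltr_pwDl.
have Sx := S0 x x0.
(* Since [S X >= X], this choice makes [kappa * S x / S X <= e / 2]. *)
pose X : R := x + 1 + 2 * kappa * S x / e.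
have p0 : 0 <= 2 * kappa * S x / e by rewrite !mulr_ge0 ?invr_ge0// ltW.
have xX : x <= X by rewrite /X -addrA lerDl addr_ge0.
have X0 : 0 < X by rewrite /X ltr_wpDr// ltr_wpDl.
have SX : 2 * kappa * S x / e <= S X.
  apply: (@le_trans _ _ (c + X)); last by rewrite cS// ltW.
  by rewrite /X addrA lerDr addr_ge0 ?(ltW c0)// addr_ge0.
have SX0 := S0 X (ltW X0).
have [T0 [_ HT0]] := hX X X0.
pose T : R := Num.max T0 0 + 1.
have T00 : 0 < T by rewrite ltr_wpDl// le_max lexx orbT.
have hXT t : T <= t -> m X * h X t <= kappa.
  move=> Tt; have /HT0 : T0 < t.
    by apply: lt_le_trans Tt; rewrite (@le_lt_trans _ _ (Num.max T0 0)) ?ltrDl// le_max lexx.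
  rewrite /ou_weight expRN -/(m X) ler_pdivlMr ?expR_gt0// mulrC => /le_trans; exact.
have [N N0 HN] : exists2 N : R, 0 <= N & forall y, 0 <= y <= X -> m y * h y T <= N * S y.
  have cmh : {within `[0, X], continuous (fun y => m y * h y T)}.
    move=> y; apply: cvgM; first by move: y; apply: continuous_subspaceT.
    move: y; apply: continuous_subspaceW (within_continuous_section _ _ _ T00 (fs_cont _ _ _ _ _ _ _ sh)).
    by move=> y /=; rewrite in_itv/= => /andP[].
  have [z _ Hz] := EVT_max (ltW X0) cmh.
  exists (`|m z * h z T| / c); first by rewrite divr_ge0// ltW.
  move=> y yX; have := Hz y; rewrite in_itv/= yX => /(_ isT) /le_trans; apply.
  apply: (le_trans (ler_norm _)); rewrite mulrAC ler_pdivlMr// ler_wpM2l//.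
  have y0 : 0 <= y by case/andP: yX.
  by apply: le_trans (cS y y0); rewrite lerDl.
have main t : T <= t -> h x t <= e / 2 + N * expR (- (alpha / S X * (t - T))) * S x.
  move=> Tt.
  have b : m x * h x t <= e / 2 + N * expR (- (alpha / S X * (t - T))) * S x.
    have xX' : 0 <= x <= X by rewrite x0.
    have := dirichlet_upper_bound _ _ _ sh h0 _ _ _ dS dS1 S0 Smono LS _ _ _ _ X0 T00 kappa0 N0 hXT HN x t xX' Tt.
    move=> /le_trans; apply; rewrite lerD2r.
    rewrite mulrAC ler_pdivrMr//.
    by move: SX; rewrite ler_pdivrMr//; lra.
  (* As [m >= 1], a bound on [m * h] is a bound on [h] wherever [h] is positive. *)
  have [hneg|hpos] := leP (h x t) 0.
    apply: (le_trans hneg); rewrite addr_ge0 ?divr_ge0 ?(ltW e0)//.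
    by rewrite !mulr_ge0 ?expR_ge0// ltW.
  apply: le_trans b; rewrite ler_peMl ?(ltW hpos)//.
  rewrite -[leLHS]expR0 ler_expR mulr_ge0 ?sqr_ge0//.
  by rewrite divr_ge0 ?mulr_ge0// ltW.
pose lam : R := alpha / S X.
have lam0 : 0 < lam by rewrite divr_gt0.
near=> t.
have Tt : T + 2 * N * S x / (e * lam) <= t.
  by near: t; apply: nbhs_pinfty_ge; exact: num_real.
have q0 : 0 <= 2 * N * S x / (e * lam) by apply: divr_ge0; [rewrite mulr_ge0 ?(ltW Sx)// mulr_ge0|rewrite mulr_ge0 ?(ltW e0) ?(ltW lam0)].
have Tt' : T <= t by apply: le_trans Tt; rewrite lerDl.
apply: (le_trans (main t Tt')); rewrite [leRHS]splitr lerD2l -/lam.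
rewrite expRN mulrAC ler_pdivrMr ?expR_gt0//.
have h1 : lam * (t - T) <= expR (lam * (t - T)).
  by apply: le_trans (expR_ge1Dx _); rewrite lerDr.
have h2 : 2 * N * S x <= e * (lam * (t - T)).
  move: Tt; rewrite -lerBrDl (ler_pdivrMr _ _ (mulr_gt0 e0 lam0)) => Tt; lra.
have h3 : e * (lam * (t - T)) <= e * expR (lam * (t - T)) by rewrite ler_pM2l.
by lra.
Unshelve. all: by end_near. Qed.

Lemma dirichlet_cvg0 h hx ht kappa (x : R) :
  forward_solution R alpha beta s h hx ht ->
  (forall t, 0 < t -> h 0 t = 0) -> 0 < kappa ->
  (forall X, 0 < X -> \forall t \near +oo, `|h X t| <= kappa * w0 X) -> 0 <= x ->
  h x t @[t --> +oo] --> 0.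
Proof.
move=> sh h0 kappa0 hX x0; apply/cvgrPdist_le => e e0.
have hXp X : 0 < X -> \forall t \near +oo, h X t <= kappa * w0 X.
  by move=> /hX; apply: filterS => t; apply: le_trans; exact: ler_norm.
have hXm X : 0 < X -> \forall t \near +oo, - h X t <= kappa * w0 X.
  by move=> /hX; apply: filterS => t; apply: le_trans; rewrite -normrN ler_norm.
have h0N t : 0 < t -> - h 0 t = 0 by move=> t0; rewrite h0// oppr0.
have up := dirichlet_limsup _ _ _ _ _ sh h0 kappa0 hXp x0 e e0.
have dn := dirichlet_limsup _ _ _ _ _ (forward_solutionN _ _ _ _ _ _ _ sh)
  h0N kappa0 hXm x0 e e0.
apply: filterS2 up dn => t up dn.
by rewrite sub0r normrN ler_norml up andbT lerNl.
Qed.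

End DirichletDecay.

(** * Superposition of the rays *)

Section FiniteSums.
Variable R : realType.

Lemma is_derive_fsum (I : Type) (r : seq I) (F : I -> R -> R) (a : I -> R) (x : R) :
  (forall i, is_derive x 1 (F i) (a i)) ->
  is_derive x 1 (fun y => \sum_(i <- r) F i y) (\sum_(i <- r) a i).
Proof.
move=> dF; elim: r => [|i r IH].
  rewrite big_nil; under eq_fun do rewrite big_nil.
  exact: is_derive_fcst.
rewrite big_cons; under eq_fun do rewrite big_cons.
exact: is_derive_fD.
Qed.

Lemma within_continuous_sum (T : topologicalType) (A : set T) (I : Type)
    (r : seq I) (F : I -> T -> R) :
  (forall i, {within A, continuous (F i)}) ->
  {within A, continuous (fun z => \sum_(i <- r) F i z)}.
Proof.
move=> cF; elim: r => [|i r IH].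
  under eq_fun do rewrite big_nil.
  by move=> z; exact: cvg_cst.
under eq_fun do rewrite big_cons.
by move=> z; apply: cvgD; [exact: cF|exact: IH].
Qed.

Variables (alpha beta s : R).

(** Serves twice: with all [c j = 1] for the total density, and with [c l = (l == j)%:R - p 0 j] for
    the deviation of ray [j] from its share of the total. *)
Lemma forward_solution_sum (d : nat) (c : 'I_d -> R)
    (q qx qt : 'I_d -> R -> R -> R) :
  (forall j, forward_solution R alpha beta s (q j) (qx j) (qt j)) ->
  forward_solution R alpha beta s (fun x t => \sum_(j < d) c j * q j x t)
    (fun x t => \sum_(j < d) c j * qx j x t) (fun x t => \sum_(j < d) c j * qt j x t).
Proof.
move=> sq; split => [| | |x t x0 t0|x t x0 t0|x t x0 t0].
- apply: (@within_continuous_sum _ _ _ _ (fun j z => c j * q j z.1 z.2)) => j z.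
  by apply: cvgM; [exact: cvg_cst|exact: (fs_cont _ _ _ _ _ _ _ (sq j))].
- apply: (@within_continuous_sum _ _ _ _ (fun j z => c j * qx j z.1 z.2)) => j z.
  by apply: cvgM; [exact: cvg_cst|exact: (fs_contx _ _ _ _ _ _ _ (sq j))].
- apply: (@within_continuous_sum _ _ _ _ (fun j z => c j * qt j z.1 z.2)) => j z.
  by apply: cvgM; [exact: cvg_cst|exact: (fs_contt _ _ _ _ _ _ _ (sq j))].
- apply: (@is_derive_fsum _ _ (fun j y => c j * q j y t)) => j.
  have d1 := fs_dx _ _ _ _ _ _ _ (sq j) x t x0 t0; derive; ring.
- apply: (@is_derive_fsum _ _ (fun j u => c j * q j x u)) => j.
  have d1 := fs_dt _ _ _ _ _ _ _ (sq j) x t x0 t0; derive; ring.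
- have -> : (fun y => s * (\sum_(j < d) c j * qx j y t) +
      alpha * (y - beta) * (\sum_(j < d) c j * q j y t)) =
    (fun y => \sum_(j < d) c j * (s * qx j y t + alpha * (y - beta) * q j y t)).
    apply/funext => y; rewrite !mulr_sumr -big_split/=.
    by apply: eq_bigr => j _; ring.
  apply: (@is_derive_fsum _ _ (fun j y => c j * (s * qx j y t + alpha * (y - beta) * q j y t))) => j.
  have d1 := fs_dflux _ _ _ _ _ _ _ (sq j) x t x0 t0.
  have d2 := is_derive_fM _ _ _ _ _ _ (is_derive_fcst _ (c j) x) d1.
  by notypeclasses refine (is_derive_eq d2 _); ring.
Qed.

End FiniteSums.

Section SpiderForward.
Variables (R : realType) (d : nat).

Lemma right_derive_eq (g : R -> R) (x a : R) : is_derive x 1 g a ->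
  right_derive g x = a.
Proof.
move=> /is_derive_quotient ga; apply: cvg_lim => //.
apply: cvg_trans ga; apply: cvg_app.
by apply: within_subset => h /=; exact: lt0r_neq0.
Qed.

Lemma derivable_is_derive (g : R -> R) (x : R) : derivable g x 1 ->
  is_derive x 1 g (derive1 g x).
Proof. by move=> dg; apply: DeriveDef => //; rewrite derive1E. Qed.

(** The right derivative supplies the boundary value of [qx]; for [x > 0] it is the ordinary one,
    and the forward equation is the derivative of the flux. *)
Lemma spider_forward_solution (alpha beta sigma : R) (C : 'M[R]_d) (l0 : 'I_d)
    (f : R -> 'I_d -> R -> R) (j : 'I_d) :
  ou_spider_density alpha beta sigma C l0 f ->
  forward_solution R alpha beta (sigma ^+ 2 / 2) (fun x t => f x j t)
    (fun x t => right_derive (fun y => f y j t) x) (fun x t => derive1 (f x j) t).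
Proof.
case=> reg _ _ fwd _ _ _; have [cf _ df cfx [cft cfxx]] := reg j.
have dfx (x t : R) : 0 < x -> 0 < t ->
    is_derive x 1 (fun y => f y j t) (derive1 (fun y => f y j t) x).
  by move=> x0 t0; have [/derivable_is_derive] := df x t x0 t0.
have rE (x t : R) : 0 < x -> 0 < t ->
    right_derive (fun y => f y j t) x = derive1 (fun y => f y j t) x.
  by move=> x0 t0; apply: right_derive_eq; exact: dfx.
split; [exact: cf|exact: cfx|exact: cft|..] => x t x0 t0.
- by rewrite rE//; exact: dfx.
- by have [_ _ /derivable_is_derive] := df x t x0 t0.
- have [_ /derivable_is_derive dfxx _] := df x t x0 t0.
  have d1 := dfx x t x0 t0.
  have d2 : is_derive x 1 (fun y => right_derive (fun y => f y j t) y)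
      (derive1 (derive1 (fun y => f y j t)) x).
    apply: near_eq_is_derive dfxx.
    by apply: filterS (near_lt _ _ _ x0) => y y0; rewrite rE.
  have d3 : is_derive x 1 (fun y => - alpha * (y - beta) * f y j t)
      (- alpha * f x j t - alpha * (x - beta) * derive1 (fun y => f y j t) x).
    by derive; ring.
  have E3 : derive1 (fun y => - alpha * (y - beta) * f y j t) x =
      - alpha * f x j t - alpha * (x - beta) * derive1 (fun y => f y j t) x.
    by rewrite derive1E; exact: (@derive_val _ _ _ _ _ _ _ d3).
  rewrite (fwd x j t x0 t0) E3.
  derive; rewrite rE//.
  have -> : derive1n 2 (fun y => f y j t) x = derive1 (derive1 (fun y => f y j t)) x by [].
  by field.
Qed.

End SpiderForward.

(** * The Gaussian integral behind the error function *)

Section Gauss.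
Variable R : realType.
Notation mu := (@lebesgue_measure R).

Definition gauss_primitive (x : R) : R :=
  \int[mu]_(t in `[0, x]) expR (- t ^+ 2) - \int[mu]_(t in `[x, 0]) expR (- t ^+ 2).

Let gauss (x : R) : R := expR (- x ^+ 2).

Let cgauss : continuous gauss.
Proof. exact: continuous_gauss_fun. Qed.

Let gauss_int (a b : R) : mu.-integrable `[a, b] (EFin \o gauss).
Proof.
by apply: continuous_compact_integrable; [exact: segment_compact|exact: continuous_subspaceT].
Qed.

(** A base point [- A] to the left of both [0] and [x] replaces the oriented integral by integrals
    with a fixed lower end, to which the fundamental theorem of calculus applies. *)
Lemma gauss_primitiveE (A x : R) : 0 < A -> - A < x ->
  gauss_primitive x = \int[mu]_(t in `[- A, x]) gauss t - \int[mu]_(t in `[- A, 0]) gauss t.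
Proof.
move=> A0 Ax; rewrite /gauss_primitive.
have [x0|x0] := leP 0 x.
  have -> : \int[mu]_(t in `[x, 0]) expR (- t ^+ 2) = 0.
    move: x0; rewrite le_eqVlt => /orP[/eqP<-|x0].
      by rewrite set_itv1 Rintegral_set1.
    by rewrite set_itv_ge ?Rintegral_set0// bnd_simp -ltNge.
  rewrite subr0 Rintegral_itvB ?bnd_simp// ?ltW ?oppr_lt0//.
  rewrite Rintegral_itv_obnd_cbnd//; apply: integrableS (gauss_int 0 x) => //.
  exact: subset_itv_oc_cc.
have -> : \int[mu]_(t in `[0, x]) expR (- t ^+ 2) = 0.
  by rewrite set_itv_ge ?Rintegral_set0// bnd_simp -ltNge.
rewrite -[RHS]opprB sub0r Rintegral_itvB ?bnd_simp// ?ltW//.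
rewrite Rintegral_itv_obnd_cbnd//; apply: integrableS (gauss_int x 0) => //.
exact: subset_itv_oc_cc.
Qed.

Lemma is_derive_gauss_primitive (x : R) :
  is_derive x 1 gauss_primitive (gauss x).
Proof.
pose A := `|x| + 1.
have A0 : 0 < A by rewrite ltr_wpDl.
have Ax : - A < x.
  by rewrite ltrNl (@le_lt_trans _ _ `|x|) ?ltrDl// -normrN ler_norm.
pose F (y : R) := \int[mu]_(t in `[- A, y]) gauss t - \int[mu]_(t in `[- A, 0]) gauss t.
have dF : is_derive x 1 F (gauss x).
  have [|dG GE] := @continuous_FTC1_closed R gauss (- A) x (x + 1) _ (gauss_int _ _) Ax (cgauss x).
    by rewrite ltrDl.
  have dG' := DeriveDef dG (etrans (esym (derive1E _ _)) GE).
  have := is_derive_fD _ _ _ _ _ _ dG' (is_derive_fcst _ (- \int[mu]_(t in `[- A, 0]) gauss t) x).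
  by rewrite addr0.
apply: near_eq_is_derive dF.
by apply: filterS (near_lt _ _ _ Ax) => y Ay; rewrite /F -gauss_primitiveE.
Qed.

Lemma gauss_primitive0 : gauss_primitive 0 = 0.
Proof. by rewrite /gauss_primitive subrr. Qed.

(** The sum of the values at [y] and [- y] has zero derivative, the Gaussian being even, and
    vanishes at 0. *)
Lemma gauss_primitiveN (x : R) : gauss_primitive (- x) = - gauss_primitive x.
Proof.
have dD (y : R) : is_derive y 1 (fun y => gauss_primitive y + gauss_primitive (0 - y)) 0.
  have d1 := is_derive_gauss_primitive y.
  have d2 := is_derive_fsubl _ _ _ _ _ (is_derive_gauss_primitive (0 - y)).
  by derive; rewrite /gauss sub0r sqrrN subrr.
wlog x0 : x / 0 <= x.
  move=> H; have [/H//|/ltW x0] := leP 0 x.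
  by have := H (- x); rewrite oppr_ge0 opprK => -> //; rewrite opprK.
have cD : {within `[0, x], continuous (fun y => gauss_primitive y + gauss_primitive (0 - y))}.
  by apply: derivable_within_continuous => y _; have [] := dD y.
have := @mean_value_bound R _ (fun=> 0) 0 x 0 x0 cD (fun y _ => dD y).
rewrite normr0 mul0r => /(_ (fun _ _ => lexx _)).
rewrite normr_le0 !sub0r oppr0 gauss_primitive0 addr0 subr0 addrC addr_eq0.
by move=> /eqP.
Qed.

(** The normalized Gaussian is a probability density on the half-line. Its distribution function
    tends to 1, and times [Num.sqrt pi / 2] it has the derivative and the initial value of
    [gauss_primitive]. *)
Lemma cvg_gauss_primitive : gauss_primitive x @[x --> +oo] --> Num.sqrt pi / 2.
Proof.
have c0 : 0 < Num.sqrt (pi : R) / 2 by rewrite divr_gt0// sqrtr_gt0 pi_gt0.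
pose phi (x : R) := (Num.sqrt pi / 2)^-1 * gauss x.
have phi1 : (\int[mu]_(x in `[0%R, +oo[) (phi x)%:E = 1)%E.
  under eq_integral do rewrite EFinM.
  rewrite ge0_integralZl_EFin//=.
  - by rewrite integral0y_gauss -EFinM mulVf// gt_eqF.
  - by move=> x _; rewrite lee_fin expR_ge0.
  - by apply: measurable_funTS; apply/measurable_EFinP; exact: continuous_measurable_fun.
have [|x _|G [G0 cG dG _ G1]] := density_primitive R phi _ _ phi1.
- by apply: continuous_subspaceT => x; apply: cvgM; [exact: cvg_cst|exact: cgauss].
- by rewrite mulr_ge0 ?expR_ge0// invr_ge0 ltW.
have GE x : 0 <= x -> gauss_primitive x = Num.sqrt pi / 2 * G x.
  move=> x0.
  have dD (y : R) : 0 < y < x ->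
      is_derive y 1 (fun y => gauss_primitive y - Num.sqrt pi / 2 * G y) 0.
    move=> /andP[y0 _]; have d1 := is_derive_gauss_primitive y; have d2 := dG y y0.
    by derive; rewrite mulr0 addr0 /phi mulrA divff ?gt_eqF// mul1r subrr.
  have cD : {within `[0, x], continuous (fun y => gauss_primitive y - Num.sqrt pi / 2 * G y)}.
    move=> y; apply: cvgB; last apply: cvgM; last 2 first.
    - exact: cvg_cst.
    - move: y; apply: continuous_subspaceW cG.
      by move=> y /=; rewrite in_itv/= => /andP[].
    - move: y; apply: derivable_within_continuous => y _.
      by have [] := is_derive_gauss_primitive y.
  have := @mean_value_bound R _ (fun=> 0) 0 x 0 x0 cD dD.
  rewrite normr0 mul0r => /(_ (fun _ _ => lexx _)).
  by rewrite normr_le0 gauss_primitive0 G0 mulr0 subrr subr0 subr_eq0 => /eqP.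
rewrite -[Num.sqrt pi / 2]mulr1.
have : Num.sqrt pi / 2 * G x @[x --> +oo] --> Num.sqrt pi / 2 * (1 : R).
  by apply: cvgM G1; exact: cvg_cst.
apply: cvg_trans; apply: near_eq_cvg; near=> x.
by rewrite GE//; near: x; apply: nbhs_pinfty_ge; exact: num_real.
Unshelve. all: by end_near. Qed.

End Gauss.

(** * The limit law *)

Section StationaryDensity.
Variable R : realType.
Variables (alpha beta sigma : R).
Hypotheses (alpha0 : 0 < alpha) (sigma0 : 0 < sigma).
Notation mu := (@lebesgue_measure R).

Let w (x : R) : R := expR (- (2 * alpha * x / sigma ^+ 2 * (x / 2 - beta))).

Let dw (x : R) : is_derive x 1 w (- (2 * alpha / sigma ^+ 2 * (x - beta)) * w x).
Proof. by rewrite /w; derive; field; rewrite gt_eqF. Qed.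

Let cw : continuous w.
Proof. by move=> x; apply/differentiable_continuous/derivable1_diffP; have [] := dw x. Qed.

Let a : R := Num.sqrt alpha / sigma.

Let a0 : 0 < a. Proof. by rewrite divr_gt0// sqrtr_gt0. Qed.

(** The primitive of [w] vanishing at 0, found by completing the square: the exponent of [w] is
    [alpha * beta ^+ 2 / sigma ^+ 2 - a ^+ 2 * (x - beta) ^+ 2]. *)
Let W (x : R) : R := expR (alpha * beta ^+ 2 / sigma ^+ 2) / a *
  (gauss_primitive R (- (a * beta) + a * x) + gauss_primitive R (a * beta)).

Let dW (x : R) : is_derive x 1 W (w x).
Proof.
have d1 := is_derive_affine _ _ _ _ _ _ (is_derive_gauss_primitive R (- (a * beta) + a * x)).
rewrite /W; derive; rewrite !mulr0 !addr0 mulrA divfK ?gt_eqF// -expRD /w; congr expR.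
have -> : (- (a * beta) + a * x) ^+ 2 = a ^+ 2 * (x - beta) ^+ 2 by ring.
rewrite /a expr_div_n sqr_sqrtr ?(ltW alpha0)//.
by field; rewrite gt_eqF.
Qed.

Let W0 : W 0 = 0.
Proof. by rewrite /W mulr0 addr0 gauss_primitiveN addNr mulr0. Qed.

Let WQ : W x @[x --> +oo] --> normalizing_constant alpha beta sigma.
Proof.
have -> : normalizing_constant alpha beta sigma =
    expR (alpha * beta ^+ 2 / sigma ^+ 2) / a *
    (Num.sqrt pi / 2 + gauss_primitive R (a * beta)).
  have -> : gauss_primitive R (a * beta) = Num.sqrt pi / 2 * erf (a * beta).
    rewrite /erf -/(gauss_primitive R (a * beta)).
    by field; rewrite gt_eqF// sqrtr_gt0 pi_gt0.
  rewrite /normalizing_constant -/a.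
  have -> : a^-1 = sigma / Num.sqrt alpha by rewrite /a invf_div.
  by field; rewrite gt_eqF// sqrtr_gt0.
apply: cvgM; first exact: cvg_cst.
apply: cvgD; last exact: cvg_cst.
apply: (@cvg_comp _ _ _ (fun x => - (a * beta) + a * x) (gauss_primitive R) _ (+oo : set_system R)); last exact: cvg_gauss_primitive.
apply/cvgryPge => M; near=> x.
rewrite -lerBlDl -ler_pdivrMl//; near: x; apply: nbhs_pinfty_ge; exact: num_real.
Unshelve. all: by end_near. Qed.

Lemma stationary_integral :
  (\int[mu]_(x in `[0%R, +oo[)
     (expR (- (2 * alpha * x / sigma ^+ 2 * (x / 2 - beta))))%:E
   = (normalizing_constant alpha beta sigma)%:E)%E.
Proof.
rewrite (@ge0_continuous_FTC2y R w W 0 (normalizing_constant alpha beta sigma)).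
- by rewrite W0 sube0.
- by move=> x _; exact: expR_ge0.
- exact: continuous_subspaceT.
- exact: WQ.
- by move=> x _; have [] := dW x.
- apply: cvg_at_right_filter.
  by apply/differentiable_continuous/derivable1_diffP; have [] := dW 0.
- by move=> x _; rewrite derive1E; exact: (@derive_val _ _ _ _ _ _ _ (dW x)).
Qed.

(** The constant is the limit at infinity of [W], which increases strictly from [W 0 = 0]. *)
Lemma normalizing_constant_gt0 : 0 < normalizing_constant alpha beta sigma.
Proof.
have incr (x y : R) : x < y -> W x < W y.
  move=> xy.
  have dWxy z : z \in `]x, y[ -> is_derive z 1 W (w z) by move=> _; exact: dW.
  have cWxy : {within `[x, y], continuous W}.
    by apply: derivable_within_continuous => z _; have [] := dW z.
  have [c _ E] := MVT xy dWxy cWxy.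
  by rewrite -subr_gt0 E mulr_gt0 ?subr_gt0// expR_gt0.
apply: (@lt_le_trans _ _ (W 1)); first by rewrite -W0 incr.
apply: (cvgr_to_ge WQ); near=> x; apply/ltW/incr.
by near: x; apply: nbhs_pinfty_gt; exact: num_real.
Unshelve. all: by end_near. Qed.

End StationaryDensity.

(** * Convergence of the total density *)

Section Convergence.
Variable R : realType.
Notation mu := (@lebesgue_measure R).

Lemma outward_solutionB (alpha beta s : R) E Ex Exx F Fx Fxx :
  outward_solution R alpha beta s E Ex Exx ->
  outward_solution R alpha beta s F Fx Fxx ->
  outward_solution R alpha beta s (fun x t => E x t - F x t)
    (fun x t => Ex x t - Fx x t) (fun x t => Exx x t - Fxx x t).
Proof.
case=> cE cEx dEx dExx dEt E0 [cF cFx dFx dFxx dFt F0].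
split => [| |x t x0 t0|x t x0 t0|x t x0 t0|t t0].
- by move=> z; apply: cvgB; [exact: cE|exact: cF].
- by move=> z; apply: cvgB; [exact: cEx|exact: cFx].
- by have d1 := dEx x t x0 t0; have d2 := dFx x t x0 t0; derive.
- by have d1 := dExx x t x0 t0; have d2 := dFxx x t x0 t0; derive.
- by have d1 := dEt x t x0 t0; have d2 := dFt x t x0 t0; derive; ring.
- by rewrite E0// F0// subrr.
Qed.

Lemma stationary_outward_solution (alpha beta s : R) (W w w' : R -> R) :
  W 0 = 0 -> {within [set x | 0 <= x], continuous W} -> continuous w ->
  (forall x : R, 0 < x -> is_derive x 1 W (w x)) ->
  (forall x : R, is_derive x 1 w (w' x)) ->
  (forall x, s * w' x + alpha * (x - beta) * w x = 0) ->
  outward_solution R alpha beta s (fun x _ => W x) (fun x _ => w x) (fun x _ => w' x).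
Proof.
move=> W0 cW cw dW dw eqw; split => // [| |x t x0 t0|x t x0 t0].
- apply: (@within_continuous_comp_sub R (R * R)%type R _ [set x | 0 <= x] W
    (fun z => z.1)) cW => [z|z []//].
  exact: cvg_fst.
- apply: continuous_subspaceT => z; apply: (@cvg_comp _ _ _ fst w); last exact: cw.
  exact: cvg_fst.
- exact: dW.
- by rewrite eqw; exact: is_derive_fcst.
Qed.

(** The primitives of [g] and of the limit density are both distribution functions: they differ by
    at most 1 and have the same limit at infinity. Their difference is an outward solution, whose
    gradient [g - w] therefore tends to 0. *)
Lemma reflected_cvg (alpha beta sigma : R) (g gx gt : R -> R -> R) :
  0 < alpha -> 0 < sigma ->
  forward_solution R alpha beta (sigma ^+ 2 / 2) g gx gt ->
  (forall t, 0 < t -> sigma ^+ 2 / 2 * gx 0 t + alpha * (0 - beta) * g 0 t = 0) ->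
  (forall x t, 0 <= x -> 0 < t -> 0 <= g x t) ->
  (forall t, 0 < t -> (\int[mu]_(x in `[0%R, +oo[) (g x t)%:E = 1)%E) ->
  forall x, 0 <= x -> g x t @[t --> +oo] -->
    (normalizing_constant alpha beta sigma)^-1 *
      expR (- (2 * alpha * x / sigma ^+ 2 * (x / 2 - beta))).
Proof.
move=> alpha0 sigma0 sg flux g0 g1 x0 x00.
have s0 : 0 < sigma ^+ 2 / 2 by rewrite divr_gt0// exprn_gt0.
have Q0 := normalizing_constant_gt0 _ _ beta _ alpha0 sigma0.
set Q := normalizing_constant alpha beta sigma in Q0 *.
pose w (x : R) : R := Q^-1 * expR (- (2 * alpha * x / sigma ^+ 2 * (x / 2 - beta))).
pose w' (x : R) : R := - (2 * alpha / sigma ^+ 2 * (x - beta)) * w x.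
have dw (x : R) : is_derive x 1 w (w' x).
  by rewrite /w; derive; rewrite /w' /w; field; rewrite !gt_eqF.
have cw : continuous w.
  by move=> x; apply/differentiable_continuous/derivable1_diffP; have [] := dw x.
have cexp : continuous (fun x : R => expR (- (2 * alpha * x / sigma ^+ 2 * (x / 2 - beta)))).
  have -> : (fun x : R => expR (- (2 * alpha * x / sigma ^+ 2 * (x / 2 - beta)))) =
      (fun x => Q * w x).
    by apply/funext => x; rewrite /w mulrA divff ?mul1r// gt_eqF.
  by move=> x; apply: cvgM; [exact: cvg_cst|exact: cw].
have w1 : (\int[mu]_(x in `[0%R, +oo[) (w x)%:E = 1)%E.
  under eq_integral do rewrite EFinM.
  rewrite ge0_integralZl_EFin//=.
  - by rewrite stationary_integral// -EFinM mulVf// gt_eqF.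
  - by apply: measurable_funTS; apply/measurable_EFinP; exact: continuous_measurable_fun.
  - by rewrite invr_ge0 ltW.
have w0 x : 0 <= x -> 0 <= w x by move=> _; rewrite mulr_ge0 ?expR_ge0// invr_ge0 ltW.
have [W [W0 cW dW W01 W1]] := density_primitive R w (continuous_subspaceT cw) w0 w1.
have /choice[G HG] : forall t, exists G : R -> R, 0 < t ->
    [/\ G 0 = 0, {within [set x | 0 <= x], continuous G},
    forall x : R, 0 < x -> is_derive x 1 G (g x t),
    forall x, 0 <= x -> 0 <= G x <= 1 & (G x @[x --> +oo] --> (1 : R))].
  (* For [t <= 0] nothing is required, and the zero function is a default. *)
  move=> t; have [t0|t0] := ltP 0 t; last by exists 0.
  have [G HG] := density_primitive R (g^~ t)
    (within_continuous_section _ _ _ t0 (fs_cont _ _ _ _ _ _ _ sg))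
    (fun x x0 => g0 x t x0 t0) (g1 t t0).
  by exists G.
have sG : outward_solution R alpha beta (sigma ^+ 2 / 2) (fun x t => G t x) g gx.
  apply: primitive_outward_solution sg flux _ _ _ => [t t0|t t0|x t x0' t0];
    have [? ? ? _ _] := HG t t0 => //; by auto.
have sW : outward_solution R alpha beta (sigma ^+ 2 / 2)
    (fun x _ => W x) (fun x _ => w x) (fun x _ => w' x).
  apply: stationary_outward_solution => // x.
  by rewrite /w'; field; rewrite gt_eqF.
have sE := outward_solutionB _ _ _ _ _ _ _ _ _ sG sW.
have := outward_gradient_cvg0 _ _ beta _ alpha0 s0 _ _ _ x0 sE _ _ x00.
move=> H.
have {}H : g x0 t - w x0 @[t --> +oo] --> 0.
  apply: H.
  - move=> x t x0' t0; have [_ _ _ /(_ x x0') /andP[a1 a2] _] := HG t t0.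
    have /andP[b1 b2] := W01 x x0'.
    by rewrite ler_norml; lra.
  - have [_ _ _ _ G1] := HG 1 ltr01.
    by rewrite -[0](subrr (1 : R)); apply: cvgB.
have : g x0 t - w x0 + w x0 @[t --> +oo] --> 0 + w x0.
  by apply: cvgD; [exact: H|exact: cvg_cst].
by rewrite add0r; under eq_fun do rewrite subrK.
Qed.

End Convergence.

(** * Stationary vectors of the switching matrix and convergence on each ray *)

Lemma stationary_unique_scale (R : realType) (d : nat) (C : 'M[R]_d) (p v : 'rV[R]_d) :
  unique (stationary_distribution C) p -> (forall j, 0 <= v 0 j) -> v *m C = v ->
  forall j, v 0 j = p 0 j * \sum_l v 0 l.
Proof.
move=> [_ puniq] v0 vC j; set S := \sum_l v 0 l.
have S0 : 0 <= S by exact: sumr_ge0.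
(* If the total vanishes, so does every entry; otherwise [v] divided by its total is a stationary
   distribution, hence [p]. *)
move: (S0); rewrite le_eqVlt => /orP[/eqP SE|S1].
  have : v 0 j <= S by rewrite /S (bigD1 j)//= lerDl sumr_ge0.
  by rewrite -SE mulr0 => vj; apply/eqP; rewrite eq_le vj v0.
have -> : p = S^-1 *: v.
  apply: puniq; split.
  - by move=> i; rewrite mxE mulr_ge0// invr_ge0.
  - by under eq_bigr do rewrite mxE; rewrite -mulr_sumr mulVf// gt_eqF.
  - by rewrite -scalemxAl vC.
by rewrite mxE mulrAC mulVf ?mul1r// gt_eqF.
Qed.

Theorem proposition5p3 (R : realType) (d : nat) (C : 'M[R]_d) (p : 'rV[R]_d)
    (l0 : 'I_d) (alpha beta sigma : R) (f : R -> 'I_d -> R -> R)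
    (halpha : 0 < alpha) (hsigma : 0 < sigma)
    (hC : stochastic_matrix C)
    (hp : unique (stationary_distribution C) p)
    (hf : ou_spider_density alpha beta sigma C l0 f) :
  let w2 := asymptotic_density f in
  let w := fun x : R => \sum_(j < d) w2 x j in
  let Q := normalizing_constant alpha beta sigma in
  [/\ forall x j, 0 <= x -> f x j t @[t --> +oo] --> w2 x j,
      forall x j, 0 <= x -> w2 x j = w x * p 0 j,
      forall x, 0 <= x ->
        w x = Q^-1 * expR (- (2 * alpha * x / sigma ^+ 2 * (x / 2 - beta)))
    & (\int[@lebesgue_measure R]_(x in `[0%R, +oo[)
         (expR (- (2 * alpha * x / sigma ^+ 2 * (x / 2 - beta))))%:E
       = Q%:E)%E].
Proof.
move=> w2 w Q.
have Q0 : 0 < Q by exact: normalizing_constant_gt0.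
have s0 : 0 < sigma ^+ 2 / 2 by rewrite divr_gt0// exprn_gt0.
have [[p0 p1 pC] _] := hp.
have fj j := spider_forward_solution R d _ _ _ _ _ _ j hf.
pose fx x j t := right_derive (fun y => f y j t) x.
pose ft x j t := derive1 (f x j) t.
have comb c := forward_solution_sum R alpha beta (sigma ^+ 2 / 2) d c
  (fun j x t => f x j t) (fun j x t => fx x j t) (fun j x t => ft x j t) fj.
pose g x t := \sum_(j < d) f x j t.
have f_ge0 x j t : 0 <= x -> 0 < t -> 0 <= f x j t.
  by move=> x0 t0; have [+ _] := ousd_density hf t0; exact.
have sg : forward_solution R alpha beta (sigma ^+ 2 / 2) g
    (fun x t => \sum_(j < d) fx x j t) (fun x t => \sum_(j < d) ft x j t).
  have sum1 (F : R -> 'I_d -> R -> R) : (fun x t => \sum_(j < d) 1 * F x j t) =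
      (fun x t => \sum_(j < d) F x j t).
    by apply/funext => x; apply/funext => t; apply: eq_bigr => j _; rewrite mul1r.
  by have := comb (fun=> 1); rewrite /= (sum1 f) (sum1 fx) (sum1 ft).
pose u x := Q^-1 * expR (- (2 * alpha * x / sigma ^+ 2 * (x / 2 - beta))).
have g_cvg x : 0 <= x -> g x t @[t --> +oo] --> u x.
  move=> x0; apply: (reflected_cvg _ _ _ _ _ _ _ halpha hsigma sg) => //.
  (* Up to sign, the sum in [zero_flux_at_origin] is the flux of [g] at [x = 0]. *)
  - move=> t t0; have := ousd_flux hf t0.
    rewrite sumrB -!mulr_sumr => h.
    have -> : \sum_(j < d) fx 0 j t = \sum_(j < d) right_derive (fun x => f x j t) 0 by [].
    by rewrite /g; lra.
  - by move=> y t y0 t0; apply: sumr_ge0 => j _; exact: f_ge0.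
  - move=> t t0; have [_ <-] := ousd_density hf t0.
    rewrite -ge0_integral_sum//.
    + by apply: eq_integral => y _; rewrite sumEFin.
    + move=> j; apply/measurable_EFinP.
      apply: subspace_continuous_measurable_fun => //.
      apply: continuous_subspaceW (within_continuous_section _ (fun x t => f x j t) _ t0 (fs_cont _ _ _ _ _ _ _ (fj j))).
      by move=> y /=; rewrite in_itv/= andbT.
    + by move=> j y; rewrite /= in_itv/= andbT => y0; rewrite lee_fin f_ge0.
have f_cvg x j : 0 <= x -> f x j t @[t --> +oo] --> p 0 j * u x.
  move=> x0.
  (* With these coefficients the combination of the rays is [f x j t - p 0 j * g x t]. *)
  pose c l : R := (l == j)%:R - p 0 j.
  have cE y t : \sum_(l < d) c l * f y l t = f y j t - p 0 j * g y t.
    rewrite /c; under eq_bigr do rewrite mulrBl.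
    rewrite sumrB -mulr_sumr; congr (_ - _).
    rewrite (bigD1 j)//= eqxx mul1r big1 ?addr0// => l /negbTE ->.
    by rewrite mul0r.
  have hcvg : \sum_(l < d) c l * f x l t @[t --> +oo] --> 0.
    (* [Q^-1 * expR (alpha * beta ^+ 2 / sigma ^+ 2)] is the ratio of [u] to [ou_weight]; adding 1
       leaves room for [g], which tends to [u], to be eventually below. *)
    apply: (dirichlet_cvg0 _ _ beta _ halpha s0 _ _ _ (Q^-1 * expR (alpha * beta ^+ 2 / sigma ^+ 2) + 1) _ (comb c)) => //.
    - move=> t t0; rewrite cE.
      have := stationary_unique_scale _ _ _ _ (\row_l f 0 l t) hp _ _ j.
      rewrite mxE => ->; last 2 first.
      + by move=> l; rewrite mxE f_ge0.
      + apply/rowP => l; rewrite !mxE (ousd_switching hf _ t0).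
        by apply: eq_bigr => i _; rewrite mxE mulrC.
      by rewrite /g; under eq_bigr do rewrite mxE; rewrite subrr.
    - by rewrite ltr_wpDl// mulr_ge0 ?expR_ge0// invr_ge0 ltW.
    - move=> X X0.
      have wX : ou_weight alpha beta (sigma ^+ 2 / 2) X > 0 by exact: expR_gt0.
      have := g_cvg X (ltW X0) => /cvgr_lt /(_ ((Q^-1 * expR (alpha * beta ^+ 2 / sigma ^+ 2) + 1) * ou_weight alpha beta (sigma ^+ 2 / 2) X)).
      have -> : u X = Q^-1 * expR (alpha * beta ^+ 2 / sigma ^+ 2) * ou_weight alpha beta (sigma ^+ 2 / 2) X.
        rewrite /u /ou_weight -[RHS]mulrA -expRD; congr (_ * expR _).
        by field; rewrite gt_eqF.
      rewrite mulrDl mul1r ltrDl => /(_ wX) near1.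
      apply: filterS2 near1 (nbhs_pinfty_gt (num_real (0 : R))) => t gt t0.
      (* [f X j t] and [p 0 j * g X t] both lie between 0 and [g X t], and so does the absolute
         value of their difference. *)
      rewrite cE (le_trans _ (ltW gt))//.
      have gX : 0 <= g X t by apply: sumr_ge0 => l _; rewrite f_ge0// ltW.
      have fX : f X j t <= g X t.
        by rewrite /g (bigD1 j)//= lerDl sumr_ge0// => l _; rewrite f_ge0// ltW.
      have fX0 : 0 <= f X j t by rewrite f_ge0// ltW.
      have pj1 : p 0 j <= 1 by rewrite -p1 (bigD1 j)//= lerDl sumr_ge0.
      have pg : p 0 j * g X t <= g X t by rewrite ler_piMl.
      have pg0 : 0 <= p 0 j * g X t by rewrite mulr_ge0.
      by rewrite ler_norml; lra.
  have : (\sum_(l < d) c l * f x l t) + p 0 j * g x t @[t --> +oo] --> 0 + p 0 j * u x.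
    by apply: cvgD hcvg _; apply: cvgM; [exact: cvg_cst|exact: g_cvg].
  by rewrite add0r; under eq_fun do rewrite cE subrK.
have w2E x j : 0 <= x -> w2 x j = p 0 j * u x.
  by move=> x0; apply: cvg_lim => //; exact: f_cvg.
have wE x : 0 <= x -> w x = u x.
  move=> x0; rewrite /w; under eq_bigr do rewrite w2E//.
  by rewrite -mulr_suml p1 mul1r.
split.
- by move=> x j x0; rewrite w2E//; exact: f_cvg.
- by move=> x j x0; rewrite w2E// wE// mulrC.
- exact: wE.
- exact: stationary_integral.
Qed.
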